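(* Let $p$ be a prime with $p\equiv 1,3,5$ or $7\pmod 8$. Let $\xi_n=\sum_{k=0}^n(-1)^{n-k}3^{n-3k}\frac{(3k)!}{k!^3}\binom{n}{3k}\binom{n+k}{n}$ (Almkvist–Zudilin numbers), let $f_\xi\in\mathbb{F}_p[[t]]$ be the reduction modulo $p$ of $\sum_{n\ge0}\xi_nt^n$, and let $A_{\xi,p}=\sum_{n=0}^{p-1}\xi_nt^n\in\mathbb{F}_p[t]$. Let $S\subset\mathbb{F}_p^\times$ be the subgroup of squares, and identify $\mathrm{Gal}(\mathbb{F}_p(t,f_\xi)/\mathbb{F}_p(t))$ with its image in $\mathbb{F}_p^\times$ under the injective homomorphism $\sigma\mapsto\sigma(f_\xi)/f_\xi$. Then there exists a polynomial $B_{\xi,p}\in\mathbb{F}_p[t]$ such that: - if $p\equiv 1,3\pmod 8$, then $A_{\xi,p}=B_{\xi,p}^2$ and $\mathrm{Gal}(\mathbb{F}_p(t,f_\xi)/\mathbb{F}_p(t))=S$; - if $p\equiv 5,7\pmod 8$, then $A_{\xi,p}=(81t^2+14t+1)B_{\xi,p}^2$ and $\mathrm{Gal}(\mathbb{F}_p(t,f_\xi)/\mathbb{F}_p(t))=\mathbb{F}_p^\times$.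
   Context: The numbers $\xi_n$ are integers, so their reductions modulo $p$ make sense. $\mathbb{F}_p(t,f_\xi)$ is the subfield of $\mathbb{F}_p((t))$ generated over $\mathbb{F}_p(t)$ by $f_\xi$. One has $f_\xi=A_{\xi,p}f_\xi^p$ in $\mathbb{F}_p[[t]]$, so $f_\xi^{p-1}=A_{\xi,p}^{-1}$, the extension is a Kummer extension, and $\sigma\mapsto\sigma(f_\xi)/f_\xi$ is an injective group homomorphism into $\mathbb{F}_p^\times$. *)

(* Defs.v *)
From HB Require Import structures.
From mathcomp Require Import all_boot all_order all_algebra all_fingroup.
From mathcomp Require Import boolp.

Set Implicit Arguments.
Unset Strict Implicit.
Unset Printing Implicit Defensive.

Import GRing.Theory.
Local Open Scope ring_scope.

(* F[[t]].  A dedicated record is used because the type nat -> F may carry the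
   pointwise product. *)
Record fps (F : fieldType) := Fps { fps_coef :> nat -> F }.

Section FpsRing.
Variable F : fieldType.
Implicit Types a b c : fps F.

HB.instance Definition _ := gen_eqMixin (fps F).
HB.instance Definition _ := gen_choiceMixin (fps F).

Lemma fpsP a b : (forall n, a n = b n) -> a = b.
Proof. by case: a b => [a] [b] /= /funext ->. Qed.

Definition fps_zero : fps F := Fps (fun=> 0).
Definition fps_one : fps F := Fps (fun n => (n == 0)%N%:R).
Definition fps_opp a : fps F := Fps (fun n => - a n).
Definition fps_add a b : fps F := Fps (fun n => a n + b n).
Definition fps_mul a b : fps F :=
  Fps (fun n => \sum_(i < n.+1) a i * b (n - i)%N).

Fact fps_addA : associative fps_add.
Proof. by move=> a b c; apply: fpsP => n /=; rewrite addrA. Qed.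
Fact fps_addC : commutative fps_add.
Proof. by move=> a b; apply: fpsP => n /=; rewrite addrC. Qed.
Fact fps_add0 : left_id fps_zero fps_add.
Proof. by move=> a; apply: fpsP => n /=; rewrite add0r. Qed.
Fact fps_addN : left_inverse fps_zero fps_opp fps_add.
Proof. by move=> a; apply: fpsP => n /=; rewrite addNr. Qed.

HB.instance Definition _ :=
  GRing.isZmodule.Build (fps F) fps_addA fps_addC fps_add0 fps_addN.

Let trunc m a : {poly F} := \poly_(i < m) a i.

Let coef_mul_trunc m n a b :
  (n < m)%N -> fps_mul a b n = (trunc m a * trunc m b)`_n.
Proof.
move=> nm; rewrite coefM; apply: eq_bigr => i _; rewrite !coef_poly.
by rewrite (leq_ltn_trans (leq_subr _ _) nm) (leq_ltn_trans _ nm) // -ltnS.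
Qed.

Let trunc_mul m n a b (q : {poly F}) : (n < m)%N ->
  (trunc m (fps_mul a b) * q)`_n = (trunc m a * trunc m b * q)`_n.
Proof.
move=> nm; rewrite !coefM; apply: eq_bigr => i _; congr (_ * _).
have im : (i < m)%N by rewrite (leq_ltn_trans _ nm) // -ltnS.
by rewrite -(coef_mul_trunc _ _ im) coef_poly im.
Qed.

Fact fps_mulC : commutative fps_mul.
Proof.
by move=> a b; apply: fpsP => n; rewrite !(@coef_mul_trunc n.+1) // mulrC.
Qed.
Fact fps_mulA : associative fps_mul.
Proof.
move=> a b c; apply: fpsP => n; rewrite !(@coef_mul_trunc n.+1) //.
by rewrite trunc_mul // mulrC trunc_mul // mulrC mulrA.
Qed.
Fact fps_mul1 : left_id fps_one fps_mul.
Proof.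
move=> a; apply: fpsP => n /=; rewrite big_ord_recl /= mul1r subn0.
by rewrite big1 ?addr0 // => i _; rewrite mul0r.
Qed.
Fact fps_mulDl : left_distributive fps_mul fps_add.
Proof.
move=> a b c; apply: fpsP => n /=; rewrite -big_split /=.
by apply: eq_bigr => i _; rewrite mulrDl.
Qed.
Fact fps_one_neq0 : fps_one != 0.
Proof.
apply/eqP => /(congr1 (fun a : fps F => a 0%N)) /eqP /=.
by rewrite oner_eq0.
Qed.

HB.instance Definition _ := GRing.Zmodule_isComNzRing.Build (fps F)
  fps_mulA fps_mulC fps_mul1 fps_mulDl fps_one_neq0.

(* The units are by definition the invertible series. *)
Definition fps_unit : {pred fps F} := fun a => `[< exists b, b * a = 1 >].
Definition fps_inv a : fps F :=
  if pselect (exists b, b * a = 1) is left e then projT1 (cid e) else a.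

Fact fps_mulV : {in fps_unit, left_inverse 1 fps_inv *%R}.
Proof.
move=> a /asboolP e; rewrite /fps_inv; case: pselect => // e'.
by case: (cid e').
Qed.
Fact fps_unitP a b : b * a = 1 -> fps_unit a.
Proof. by move=> ba1; apply/asboolP; exists b. Qed.
Fact fps_inv_out : {in [predC fps_unit], fps_inv =1 id}.
Proof.
by move=> a /asboolP nu; rewrite /fps_inv; case: pselect.
Qed.

HB.instance Definition _ := GRing.ComNzRing_hasMulInverse.Build (fps F)
  fps_mulV fps_unitP fps_inv_out.

Let fps_order a : a != 0 ->
  exists2 m, a m != 0 & forall i, (i < m)%N -> a i = 0.
Proof.
move=> a0; have exa : exists m, a m != 0.
  apply/not_existsP => za; case/eqP: a0; apply: fpsP => n.
  by have := za n; case: eqP.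
exists (ex_minn exa); case: ex_minnP => // m am mmin i im; apply/eqP.
by apply: contraTT im => /mmin; rewrite -leqNgt.
Qed.

Fact fps_mulf_eq0 a b : a * b = 0 -> (a == 0) || (b == 0).
Proof.
move=> ab0; apply/norP => -[/fps_order[m am am0] /fps_order[n bn bn0]].
have /= := congr1 (fun c : fps F => c (m + n)%N) ab0.
have mmn : (m < (m + n).+1)%N by rewrite ltnS leq_addr.
rewrite (bigD1 (Ordinal mmn)) //= addKn big1 ?addr0.
  by apply/eqP; rewrite mulf_neq0.
move=> i im; have [/am0-> | mi] := ltnP i m; first by rewrite mul0r.
have {}mi : (m < i)%N by rewrite ltn_neqAle mi andbT eq_sym.
rewrite bn0 ?mulr0 // ltn_subLR ?ltn_add2r //.
by rewrite -ltnS.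
Qed.

HB.instance Definition _ :=
  GRing.ComUnitRing_isIntegral.Build (fps F) fps_mulf_eq0.

End FpsRing.

(* F((t)), the fraction field of F[[t]] *)
Notation laurent F := {fraction (fps F)}.

Definition fps_of_poly (F : fieldType) (q : {poly F}) : fps F :=
  Fps (fun n => q`_n).

Definition laurent_of_poly (F : fieldType) (q : {poly F}) : laurent F :=
  tofrac (fps_of_poly q).

(* The subfield F(t) of F((t)) *)
Definition ratfun (F : fieldType) : {pred laurent F} := fun x =>
  `[< exists q r : {poly F},
        r != 0 /\ x = laurent_of_poly q / laurent_of_poly r >].

Section Adjoin.
Variables (L : fieldType) (K : {pred L}) (x : L).

(* The subfield K(x) of L generated by K and x *)
Definition adjoin : {pred L} := fun y =>
  `[< forall E : {pred L},
        divring_closed E -> {subset K <= E} -> x \in E -> y \in E >].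

Fact adjoin_divring_closed : divring_closed adjoin.
Proof.
split.
- by apply/asboolP => E [].
- move=> y z /asboolP Ey /asboolP Ez; apply/asboolP => E dE KE xE.
  by case: (dE) => _ EB _; apply: EB; [exact: Ey | exact: Ez].
- move=> y z /asboolP Ey /asboolP Ez; apply/asboolP => E dE KE xE.
  by case: (dE) => _ _ EV; apply: EV; [exact: Ey | exact: Ez].
Qed.

HB.instance Definition _ :=
  GRing.isDivringClosed.Build L adjoin adjoin_divring_closed.

Fact adjoin_gen : x \in adjoin.
Proof. by apply/asboolP. Qed.

Fact adjoin_base : {subset K <= adjoin}.
Proof. by move=> y Ky; apply/asboolP => E _ KE _; apply: KE. Qed.

Record adjoin_field := AdjoinField {
  adjoin_val : L;
  adjoin_valP : adjoin_val \in adjoin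
}.

HB.instance Definition _ := [isSub for adjoin_val].
HB.instance Definition _ := [Choice of adjoin_field by <:].
HB.instance Definition _ :=
  [SubChoice_isSubIntegralDomain of adjoin_field by <:].
HB.instance Definition _ :=
  [SubIntegralDomain_isSubField of adjoin_field by <:].

Definition adjoin_elt : adjoin_field := AdjoinField adjoin_gen.

Definition adjoin_ground : {pred adjoin_field} := [pred y | val y \in K].

End Adjoin.

Arguments ratfun F : clear implicits.
Arguments adjoin_elt {L} K x.
Arguments adjoin_ground {L} K x.

Section Gal.
Variables (M : fieldType) (K : {pred M}).

Definition field_aut (s : M -> M) : Prop :=
  [/\ zmod_morphism s, monoid_morphism s, bijective s
    & {in K, forall y, s y = y}].

(* The group Gal(M/K) of the field automorphisms of M fixing K pointwise, under
   composition.  The Galois groups of the library only exist for extensions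
   already equipped with a finite-dimensional vector space structure. *)
Record gal := MkGal { gal_fun :> M -> M; galP : `[< field_aut gal_fun >] }.

HB.instance Definition _ := [isSub for gal_fun].
HB.instance Definition _ := [Choice of gal by <:].

Fact gal_aut (s : gal) : field_aut s.
Proof. exact/asboolP/galP. Qed.

Fact field_aut_id : `[< field_aut id >].
Proof. by apply/asboolP; split=> //; exists id. Qed.

Fact field_aut_comp (s u : gal) : `[< field_aut (s \o u) >].
Proof.
have [sB [s1 sM] sb sK] := gal_aut s; have [uB [u1 uM] ub uK] := gal_aut u.
apply/asboolP; split=> /=.
- by move=> y z /=; rewrite uB sB.
- by split=> [|y z] /=; rewrite ?u1 ?s1 // uM sM.
- exact: bij_comp.
- by move=> y Ky /=; rewrite uK // sK.
Qed.

Fact gal_has_inv (s : gal) :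
  exists u : gal, cancel s u /\ cancel u s.
Proof.
have [sB [s1 sM] [u su us] sK] := gal_aut s.
suff uP : `[< field_aut u >] by exists (MkGal uP).
apply/asboolP; split.
- by move=> y z; apply: (can_inj su); rewrite sB !us.
- by split=> [|y z]; apply: (can_inj su); rewrite us ?s1 // sM !us.
- by exists (s : M -> M).
- by move=> y Ky; rewrite -{1}(sK y Ky) su.
Qed.

Definition gal_one : gal := MkGal field_aut_id.
Definition gal_mul (s u : gal) : gal := MkGal (field_aut_comp s u).
Definition gal_inv (s : gal) : gal := projT1 (cid (gal_has_inv s)).

Fact gal_mulA : associative gal_mul.
Proof. by move=> s u v; apply: val_inj. Qed.
Fact gal_mul1 : left_id gal_one gal_mul.
Proof. by move=> s; apply: val_inj. Qed.
Fact gal_mulr1 : right_id gal_one gal_mul.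
Proof. by move=> s; apply: val_inj. Qed.
Fact gal_mulV : left_inverse gal_one gal_inv gal_mul.
Proof.
move=> s; apply: val_inj; apply: funext => y /=; rewrite /gal_inv.
by case: cid => u [su us] /=; rewrite su.
Qed.
Fact gal_mulrV : right_inverse gal_one gal_inv gal_mul.
Proof.
move=> s; apply: val_inj; apply: funext => y /=; rewrite /gal_inv.
by case: cid => u [su us] /=; rewrite us.
Qed.

HB.instance Definition _ :=
  isGroup.Build gal gal_mulA gal_mul1 gal_mulr1 gal_mulV gal_mulrV.

End Gal.

(* Gal(K(x)/K), for a subfield K of L and x in L *)
Notation gal_adjoin K x := (gal (adjoin_ground K x)).

(* Almkvist-Zudilin numbers.  The two truncated operations are harmless:
   'C(n, 3 * k) = 0 when n < 3 * k, and the quotient is exact (see xi_rat). *)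
Definition xi (n : nat) : int :=
  \sum_(0 <= k < n.+1) (-1) ^+ (n - k) *
    (3 ^ (n - 3 * k) * ((3 * k)`! %/ k`! ^ 3)
       * 'C(n, 3 * k) * 'C(n + k, n))%N%:Z.

Lemma fact3_dvd k : (k`! ^ 3 %| (3 * k)`!)%N.
Proof.
have e1 := bin_fact (leq_pmull k (isT : (0 < 3)%N)).
have e2 := bin_fact (leq_pmull k (isT : (0 < 2)%N)).
rewrite -e1 (_ : (3 * k - k = 2 * k)%N); last by rewrite mulSn addKn.
rewrite -e2 (_ : (2 * k - k = k)%N); last by rewrite mulSn addKn mul1n.
apply/dvdnP; exists ('C(3 * k, k) * 'C(2 * k, k))%N.
by rewrite !expnS expn0 muln1 -[RHS]mulnA; congr muln; rewrite mulnCA.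
Qed.

Lemma xi_rat n : (xi n)%:~R = \sum_(0 <= k < n.+1)
  (-1) ^+ (n - k) * 3%:Q ^ (n%:Z - (3 * k)%N%:Z)
    * ((3 * k)`!%:R / k`!%:R ^+ 3) * 'C(n, 3 * k)%:R * 'C(n + k, n)%:R :> rat.
Proof.
rewrite /xi rmorph_sum /=; apply: eq_bigr => k _.
rewrite rmorphM rmorphXn rmorphN1 /= -!mulrA; congr (_ * _).
rewrite -pmulrn !natrM -!mulrA.
have [n3k | kn] := ltnP n (3 * k); first by rewrite bin_small // mul0r !mulr0.
rewrite subzn // -exprnP natrX; congr (_ * _); rewrite [RHS]mulrA.
congr (_ * _); have k0 : k`!%:R ^+ 3 != 0 :> rat.
  by rewrite expf_eq0 Num.Theory.pnatr_eq0 -lt0n fact_gt0.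
by rewrite -[in RHS](divnK (fact3_dvd k)) natrM natrX mulfK.
Qed.

(* The reduction modulo p of the generating series of the xi_n *)
Definition f_xi (p : nat) : fps 'F_p := Fps (fun n => (xi n)%:~R).

Definition A_xi (p : nat) : {poly 'F_p} := \poly_(n < p) (xi n)%:~R.

(* Gal(F_p(t, f_xi) / F_p(t)) *)
Notation Gal_xi p := (gal_adjoin (ratfun 'F_p) (tofrac (f_xi p))).

(* f_xi as an element of F_p(t, f_xi) *)
Definition f_xi_elt (p : nat) :
    adjoin_field (ratfun 'F_p) (tofrac (f_xi p)) :=
  adjoin_elt (ratfun 'F_p) (tofrac (f_xi p)).

Definition squares (p : nat) : {set {unit 'F_p}} :=
  [set (v ^+ 2)%g | v : {unit 'F_p}].

Definition image_set (G : Type) (T : finType) (chi : G -> T) : {set T} :=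
  [set u | `[< exists s, chi s = u >]].

(* Main.v *)
(* Put a_k = (4k)!/k!^4 and F(x) = sum_k a_k x^k.  Resumming the definition of
   xi_n gives sum_n xi_n t^n = (1+3t)^-1 F(t^3/(1+3t)^4), and modulo p this
   truncates to A = (1+3t)^(p-1) g(t^3/(1+3t)^4) with g = sum_(k<p) a_k x^k.
   By Clausen's formula F is the square of
     2F1(1/8,3/8;1;256x) = (1-256x)^(1/2) 2F1(5/8,7/8;1;256x).
   Modulo p one of these two hypergeometric series terminates, at degree
   N = p %/ 8: the first one if p = 1, 3 mod 8 and the second one if
   p = 5, 7 mod 8.  Comparing differential equations, g = P^2 or
   g = (1-256x) P^2 for the corresponding polynomial P, and 1-256x pulls back to
   (1-t)^2 (81t^2+14t+1)/(1+3t)^4.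

   The xi_n satisfy Lucas congruences, so that f = A f^p.  Let e be the least
   positive exponent with f^e in F_p(t).  Any divisor of X^(p-1) - f^(p-1) over
   F_p(t) of degree s has constant term a multiple of f^s, so X^e - f^e is
   irreducible and the Galois group is {u | u^e = 1}.  Writing p-1 = e d makes A
   a d-th power.  The differential equation of P shows that P is separable and
   does not vanish at 1/256, hence B is squarefree if p = 1, 3 mod 8, which
   forces d = 2, and 81t^2+14t+1 is a simple factor of A if p = 5, 7 mod 8,
   which forces d = 1. *)

Require Import Defs.
From HB Require Import structures.
From mathcomp Require Import all_boot all_order all_algebra all_fingroup.
From mathcomp Require Import cyclic finfield.
From mathcomp Require Import boolp ring zify.

Set Implicit Arguments.
Unset Strict Implicit.
Unset Printing Implicit Defensive.

Import GRing.Theory.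
Local Open Scope ring_scope.

(** * Lucas congruences *)

Section Lucas.
Variables (p : nat) (p_pr : prime p).
Local Notation F := 'F_p.

Lemma natFp_eq0 n : (n%:R == 0 :> F) = (p %| n)%N.
Proof. by rewrite (dvdn_pcharf (pchar_Fp p_pr)). Qed.

Lemma natFp_neq0 n : (0 < n < p)%N -> n%:R != 0 :> F.
Proof. by case/andP=> n0 np; rewrite natFp_eq0 gtnNdvd. Qed.

Lemma factFp_neq0 n : (n < p)%N -> n`!%:R != 0 :> F.
Proof.
elim: n => [|n IHn] np; first by rewrite fact0 oner_neq0.
by rewrite factS natrM mulf_neq0 ?IHn ?natFp_neq0 // ltnW.
Qed.

Lemma expFp (x : F) : x ^+ p = x.
Proof. by have := expf_card x; rewrite card_Fp. Qed.

Lemma exprFp_comp (q : {poly F}) : q ^+ p = q \Po 'X^p.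
Proof.
have pX : p \in [pchar {poly F}] by rewrite pchar_poly pchar_Fp.
rewrite comp_polyE -{1}(coefK q) poly_def -(pFrobenius_autE pX) rmorph_sum /=.
by apply: eq_bigr => i _; rewrite pFrobenius_autE exprZn expFp -!exprM mulnC.
Qed.

(** Compare the coefficients of X^(c+pd) in (X+1)^(a+pb) = (X+1)^a (X^p+1)^b. *)
Lemma bin_lucas a b c d : (a < p)%N -> (c < p)%N ->
  'C(a + p * b, c + p * d)%:R = 'C(a, c)%:R * 'C(b, d)%:R :> F.
Proof.
have p0 := prime_gt0 p_pr.
have coefB n k : (('X + 1) ^+ n : {poly F})`_k = 'C(n, k)%:R.
  rewrite addrC exprDn coef_sum.
  under eq_bigr => i _ do rewrite expr1n mul1r coefMn coefXn.
  have [kn|nk] := ltnP k n.+1.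
    rewrite (bigD1 (Ordinal kn)) //= eqxx big1 ?addr0 // => i ik.
    by rewrite (_ : (k == i) = false) ?mul0rn // eq_sym; apply/eqP => e;
       case/eqP: ik; apply: val_inj.
  rewrite bin_small // big1 // => i _; rewrite (_ : (k == i) = false) ?mul0rn //.
  by apply/eqP => e; have := ltn_ord i; rewrite -e ltnNge nk.
move=> ap cp; rewrite -coefB exprD exprM.
rewrite exprFp_comp -rmorphXn /=.
rewrite coefM.
have cs : (c < (c + p * d).+1)%N by rewrite ltnS leq_addr.
(* Only [i = c] contributes: [i <= a < p] and [p] dividing [c + p * d - i] force it. *)
rewrite (bigD1 (Ordinal cs)) //= addKn coefB coef_comp_poly_Xn // dvdn_mulr //.
rewrite mulKn // coefB big1 ?addr0 // => i ic.
rewrite coefB coef_comp_poly_Xn //; case: ifP => [pd|]; last by rewrite mulr0.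
have [ia|ai] := ltnP a i; first by rewrite bin_small // mul0r.
have ip : (i < p)%N by apply: leq_ltn_trans ap.
case/eqP: ic; apply: val_inj => /=.
have := pd; rewrite -eqn_mod_dvd; last by rewrite -ltnS.
move/eqP=> e; rewrite -(modn_small ip) -e.
by rewrite addnC mulnC modnMDl modn_small.
Qed.

End Lucas.

(** The multinomial number n!/(k!^3 (n-3k)!), written as a product of binomials so that Lucas
    applies to each factor. *)
Definition trinom n k := ('C(n, k) * 'C(n - k, k) * 'C(n - 2 * k, k))%N.

Lemma trinom_fact n k : (3 * k <= n)%N ->
  (trinom n k * (k`! ^ 3 * (n - 3 * k)`!) = n`!)%N.
Proof.
move=> kn; rewrite /trinom.
have [k1 k2 k3] : [/\ k <= n, k <= n - k & k <= n - 2 * k]%N by split; lia.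
have e1 := bin_fact k1; have e2 := bin_fact k2; have e3 := bin_fact k3.
rewrite -e1 -e2 (_ : (n - k - k = n - 2 * k)%N) -?e3; last by lia.
rewrite (_ : (n - 2 * k - k = n - 3 * k)%N); last by lia.
by ring.
Qed.

Lemma trinom_small n k : (n < 3 * k)%N -> trinom n k = 0%N.
Proof.
move=> nk; rewrite /trinom.
have [kn|kn] := ltnP n k; first by rewrite bin_small.
have [kn2|kn2] := ltnP (n - k) k; first by rewrite (bin_small kn2) muln0.
by rewrite (@bin_small (n - 2 * k)) ?muln0 //; lia.
Qed.

Lemma trinomE n k :
  ((3 * k)`! %/ k`! ^ 3 * 'C(n, 3 * k) = trinom n k)%N.
Proof.
have [nk|kn] := ltnP n (3 * k); first by rewrite trinom_small // bin_small ?muln0.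
apply/eqP; rewrite -(@eqn_pmul2r (k`! ^ 3 * (n - 3 * k)`!)); last first.
  by rewrite muln_gt0 expn_gt0 !fact_gt0.
rewrite trinom_fact // -(bin_fact kn) -{2}(divnK (fact3_dvd k)).
by apply/eqP; ring.
Qed.

Definition xi_term (R : comNzRingType) n k : R :=
  (-1) ^+ (n - k) * 3 ^+ (n - 3 * k) * (trinom n k)%:R * 'C(n + k, k)%:R.

Lemma xi_term_small (R : comNzRingType) n k :
  (n < 3 * k)%N -> xi_term R n k = 0.
Proof. by move=> nk; rewrite /xi_term trinom_small // mulr0 mul0r. Qed.

(** The upper bound is free because the terms with [n < 3 * k] vanish; [xi_lucas] takes a multiple
    of [p]. *)
Lemma xiE (R : comNzRingType) n m : (n < m)%N ->
  (xi n)%:~R = \sum_(0 <= k < m) xi_term R n k.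
Proof.
move=> nm; rewrite [RHS](big_cat_nat (n := n.+1)) //= [X in _ = _ + X]big_nat.
rewrite [X in _ = _ + X]big1 ?addr0 => [|k /andP[nk _]]; last first.
  by rewrite xi_term_small //; lia.
rewrite /xi rmorph_sum /=; apply: eq_bigr => k _.
rewrite rmorphM rmorphXn rmorphN1 /= -pmulrn -(mulnA (3 ^ _)%N) trinomE.
rewrite -(@bin_sub (n + k) n) ?leq_addr // addKn.
by rewrite (natrM _ _ 'C(_, _)) (natrM _ _ (trinom _ _)) natrX !mulrA.
Qed.

(** Both sides equal (n+k)!/(k!^4 (n-3k)!); the right one isolates (4k)!/k!^4. *)
Lemma trinom_bin n k : (3 * k <= n)%N ->
  (trinom n k * 'C(n + k, k) = 'C(n + k, 4 * k) * trinom (4 * k) k)%N.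
Proof.
move=> kn; have kn4 : (4 * k <= n + k)%N by lia.
apply/eqP; rewrite -(@eqn_pmul2r (k`! ^ 4 * (n - 3 * k)`!)); last first.
  by rewrite muln_gt0 expn_gt0 !fact_gt0.
have e1 := trinom_fact kn; have e2 := bin_fact (leq_addl n k).
have e3 := bin_fact kn4.
have e4 := @trinom_fact (4 * k)%N k (leq_mul (isT : 3 <= 4)%N (leqnn k)).
move: e2 e3 e4; rewrite addnK (_ : (n + k - 4 * k = n - 3 * k)%N); last by lia.
rewrite (_ : (4 * k - 3 * k = k)%N); last by lia.
rewrite -e1 => e2 e3 e4; rewrite -e4 in e3; apply/eqP.
transitivity ((n + k)`!); [rewrite -e2 | rewrite -e3]; by ring.
Qed.

Section LucasXi.
Variables (p : nat) (p_pr : prime p) (p_odd : odd p).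
Local Notation F := 'F_p.

Lemma trinom_lucas a b c d : (a < p)%N -> (c < p)%N ->
  (trinom (a + p * b) (c + p * d))%:R =
  (trinom a c)%:R * (trinom b d)%:R :> F.
Proof.
move=> ap cp; rewrite /trinom !natrM bin_lucas //.
(* A digit too small for its binomial makes both sides vanish; otherwise the subtractions below
   involve no borrow. *)
have [ac|ca] := ltnP a c; first by rewrite (bin_small ac) !mul0r.
have [bd|db] := ltnP b d; first by rewrite (bin_small bd) !(mulr0, mul0r).
have -> : (a + p * b - (c + p * d) = (a - c) + p * (b - d))%N.
  by rewrite mulnBr; have := leq_mul (leqnn p) db; lia.
rewrite bin_lucas //; last by lia.
have [ac2|ca2] := ltnP (a - c)%N c.
  by rewrite (bin_small ac2) !(mulr0, mul0r).
have [bd2|db2] := ltnP (b - d)%N d.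
  by rewrite (bin_small bd2) !(mulr0, mul0r).
have -> : (a + p * b - 2 * (c + p * d) = (a - 2 * c) + p * (b - 2 * d))%N.
  rewrite mulnBr; have : (p * (2 * d) <= p * b)%N by rewrite leq_mul2l; lia.
  by lia.
rewrite bin_lucas //; last by lia.
by ring.
Qed.

Lemma bin_lucas_add a b c d : (a < p)%N -> (c < p)%N ->
  'C(a + p * b + (c + p * d), c + p * d)%:R =
  'C(a + c, c)%:R * 'C(b + d, d)%:R :> F.
Proof.
move=> ap cp.
have -> : (a + p * b + (c + p * d) = (a + c) + p * (b + d))%N by lia.
(* If [a + c] carries, both sides vanish: the low digit [a + c - p] is smaller than [c]. *)
have [acp|pac] := ltnP (a + c)%N p; first by rewrite bin_lucas.
have lt_c : (a + c - p < c)%N by lia.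
have lt_p : (a + c - p < p)%N by lia.
have -> : (a + c + p * (b + d) = (a + c - p) + p * (b + d).+1)%N by lia.
rewrite bin_lucas // (bin_small lt_c) mul0r.
suff -> : 'C(a + c, c)%:R = 0 :> F by rewrite mul0r.
have := bin_lucas p_pr 1 0 lt_p cp; rewrite muln1 muln0 addn0 subnK // => ->.
by rewrite (bin_small lt_c) mul0r.
Qed.

Local Notation T := (xi_term F).

Lemma xi_term_lucas a b c d : (a < p)%N -> (c < p)%N ->
  T (a + p * b) (c + p * d) = T a c * T b d.
Proof.
move=> ap cp; rewrite /xi_term trinom_lucas // bin_lucas_add //.
have [ac|ca] := ltnP a (3 * c)%N; first by rewrite (trinom_small ac); ring.
have [bd|db] := ltnP b (3 * d)%N; first by rewrite (trinom_small bd); ring.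
have db' := leq_mul (leqnn p) db.
have db3 : (p * d <= p * b)%N by rewrite leq_mul2l; lia.
have -> : (a + p * b - (c + p * d) = (a - c) + p * (b - d))%N.
  by rewrite mulnBr; lia.
have -> : (a + p * b - 3 * (c + p * d) = (a - 3 * c) + p * (b - 3 * d))%N.
  by rewrite mulnBr; lia.
by rewrite !exprD !exprM !expFp //; ring.
Qed.

(** Summing over k = c + pd splits the sum into a product, by [xi_term_lucas]. *)
Lemma xi_lucas a b : (a < p)%N ->
  (xi (a + p * b))%:~R = (xi a)%:~R * (xi b)%:~R :> F.
Proof.
move=> ap; have p0 := prime_gt0 p_pr.
rewrite (@xiE _ (a + p * b) (b.+1 * p)); last by rewrite mulSn; lia.
rewrite (xiE _ ap) (xiE _ (ltnSn b)) big_nat_mul mulrC mulr_suml.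
apply: eq_big_nat => d _; rewrite mulr_sumr.
rewrite -{1}[(d * p)%N]add0n big_addn mulSn addnK.
apply: eq_big_nat => c /andP[_ cp].
by rewrite [(d * p)%N]mulnC xi_term_lucas // mulrC.
Qed.

Lemma fps_exp_coef (a : fps F) (q : {poly F}) n k :
  (forall i, (i <= n)%N -> a i = q`_i) ->
  forall i, (i <= n)%N -> (a ^+ k) i = (q ^+ k)`_i.
Proof.
move=> aq; elim: k => [|k IHk] i ni; first by rewrite !expr0 coef1.
rewrite !exprS coefM; apply: eq_bigr => j _.
have ji : (j <= i)%N by rewrite -ltnS.
by rewrite aq ?IHk ?(leq_trans ji ni) // (leq_trans (leq_subr _ _) ni).
Qed.

Lemma fps_expFp (a : fps F) n :
  (a ^+ p) n = if (p %| n)%N then a (n %/ p)%N else 0.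
Proof.
have p0 := prime_gt0 p_pr.
rewrite (@fps_exp_coef _ (\poly_(i < n.+1) a i) n) // => [|i ni]; last first.
  by rewrite coef_poly ltnS ni.
rewrite exprFp_comp // coef_comp_poly_Xn // coef_poly ltnS leq_div.
by [].
Qed.

(** Since f^p = f(t^p), only the index n mod p of A can contribute to the coefficient of t^n, and
    [xi_lucas] evaluates that term. *)
Lemma f_xi_frobenius : f_xi p = fps_of_poly (A_xi p) * f_xi p ^+ p.
Proof.
have p0 := prime_gt0 p_pr.
apply: fpsP => n /=.
rewrite {1}(divn_eq n p) addnC mulnC xi_lucas ?ltn_mod //.
have ns : (n %% p < n.+1)%N by rewrite ltnS leq_mod.
rewrite (bigD1 (Ordinal ns)) //= coef_poly ltn_mod p0 fps_expFp.
have -> : (n - n %% p = n %/ p * p)%N by rewrite {1}(divn_eq n p) addnK.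
rewrite dvdn_mull // mulnK // big1 ?addr0 // => i ine.
rewrite coef_poly; case: ltnP => ip; last by rewrite mul0r.
rewrite fps_expFp; case: ifP => [pd|]; last by rewrite mulr0.
case/eqP: ine; apply: val_inj => /=.
move: pd; rewrite -eqn_mod_dvd; last by rewrite -ltnS.
by rewrite (modn_small ip) => /eqP.
Qed.
End LucasXi.

(** * Pull-back along t^3/(1+3t)^4 *)

Section Homogenization.
Variable F : fieldType.
Implicit Types G H : {poly F}.

Definition lin3 : {poly F} := 1 + 3%:P * 'X.
(* This is lin3^e G(X^3 / lin3^4), provided that 4 deg G <= e; otherwise the
   truncated subtraction makes the value meaningless. *)
Definition pull e G : {poly F} :=
  \sum_(k < size G) G`_k *: ('X^(3 * k) * lin3 ^+ (e - 4 * k)).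

Lemma coef_lin3X e m : (lin3 ^+ e)`_m = 'C(e, m)%:R * 3 ^+ m.
Proof.
rewrite exprDn coef_sum.
under eq_bigr => i _ do
  rewrite expr1n mul1r exprMn -rmorphXn /= coefMn coefCM coefXn.
have [me|em] := ltnP m e.+1.
  rewrite (bigD1 (Ordinal me)) //= eqxx mulr1 big1 ?addr0 ?mulr_natl // => i im.
  rewrite (_ : (m == i) = false) ?mulr0 ?mul0rn //; apply/eqP => mi.
  by case/eqP: im; apply: val_inj.
rewrite bin_small // mul0r big1 // => i _; rewrite (_ : (m == i) = false).
  by rewrite mulr0 mul0rn.
by apply/eqP => mi; have := ltn_ord i; rewrite -mi ltnNge em.
Qed.

Lemma lin3_neq0 : lin3 != 0.
Proof.
apply/eqP => /(congr1 (fun q : {poly F} => q`_0)) /eqP.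
by rewrite -[lin3]expr1 coef_lin3X bin0 expr0 mulr1 coef0 oner_eq0.
Qed.

(** Wherever 1+3X becomes invertible, [pull] is a genuine homogenization. This serves both in the
    fraction field, for identities, and at points. *)
Lemma pull_morph (K : fieldType) (phi : {rmorphism {poly F} -> K}) e G :
    phi lin3 != 0 -> (4 * (size G).-1 <= e)%N ->
  phi (pull e G) =
  phi lin3 ^+ e * (map_poly (phi \o polyC) G).[phi 'X ^+ 3 / phi lin3 ^+ 4].
Proof.
move=> u0 Ge.
rewrite (@horner_coef_wide _ (size G)) ?size_poly // mulr_sumr /pull rmorph_sum.
apply: eq_bigr => k _; rewrite -mul_polyC !rmorphM !rmorphXn /=.
rewrite coef_map /= [RHS]mulrCA; congr (_ * _).
have ke : (4 * k <= e)%N by have := ltn_ord k; lia.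
rewrite -[in RHS](subnK ke) exprD exprMn exprVn -!exprM mulrA.
by rewrite mulrAC mulfK ?expf_neq0 // mulrC.
Qed.

Lemma pullM e1 e2 G H : (4 * (size G).-1 <= e1)%N -> (4 * (size H).-1 <= e2)%N ->
  pull (e1 + e2) (G * H) = pull e1 G * pull e2 H.
Proof.
move=> G1 H2; apply/eqP; rewrite -tofrac_eq rmorphM /=.
have GH : (4 * (size (G * H)%R).-1 <= e1 + e2)%N.
  by have := size_polyMleq G H; lia.
have u0 : tofrac lin3 != 0 by rewrite tofrac_eq0 lin3_neq0.
by rewrite !(pull_morph (phi := @tofrac _)) // rmorphM /= hornerM exprD mulrACA.
Qed.

Lemma horner_pull e G x : 1 + 3%:R * x != 0 -> (4 * (size G).-1 <= e)%N ->
  (pull e G).[x] = (1 + 3%:R * x) ^+ e * G.[x ^+ 3 / (1 + 3%:R * x) ^+ 4].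
Proof.
have lin3E : lin3.[x] = 1 + 3%:R * x by rewrite !hornerE.
have mapE : map_poly (horner_eval x \o polyC) G = G.
  by apply/polyP => i; rewrite coef_map /= /horner_eval hornerC.
rewrite -lin3E => u0 Ge; have := @pull_morph F (horner_eval x) e G u0 Ge.
by rewrite mapE /= /horner_eval hornerX.
Qed.

Lemma pull_wide m e G : (size G <= m)%N ->
  pull e G = \sum_(k < m) G`_k *: ('X^(3 * k) * lin3 ^+ (e - 4 * k)).
Proof.
move=> Gm; rewrite /pull.
rewrite (big_ord_widen m (fun k => G`_k *: ('X^(3 * k) * lin3 ^+ (e - 4 * k)))) //.
rewrite big_mkcond; apply: eq_bigr => k _ /=.
by case: ltnP => // /(nth_default 0) ->; rewrite scale0r.
Qed.

Lemma pullD e G H : pull e (G + H) = pull e G + pull e H.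
Proof.
rewrite (pull_wide e (size_polyD G H)) (pull_wide e (leq_maxl _ (size H))).
rewrite (pull_wide e (leq_maxr (size G) _)) -big_split.
by apply: eq_bigr => k _; rewrite coefD scalerDl.
Qed.

Lemma pull1 e : pull e 1 = lin3 ^+ e.
Proof.
by rewrite /pull size_poly1 big_ord1 coef1 scale1r mul1r subn0.
Qed.

(** Chain rule: with u = 1+3X, the derivative of X^3/u^4 is 3X^2(1-X)/u^5. *)
Lemma deriv_pull e G : (4 * (size G).-1 <= e)%N ->
  lin3 * (pull e G)^`() =
  (3 * e)%:R * pull e G + 3%:R * 'X^2 * (1 - 'X) * pull (e - 4) G^`().
Proof.
case sG : (size G) => [|m] /= Ge.
  move/eqP: sG; rewrite size_poly_eq0 => /eqP->.
  by rewrite deriv0 /pull size_poly0 !big_ord0 deriv0 !mulr0 addr0.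
rewrite (@pull_wide m.+1) ?sG // (@pull_wide m _ G^`()); last first.
  by rewrite -ltnS -sG lt_size_deriv // -size_poly_eq0 sG.
(* The identity on one monomial; for [k = 0] the truncated [k.-1] is harmless because of the factor
   [k%:R]. *)
have dt k : (4 * k <= e)%N ->
    lin3 * ('X^(3 * k) * lin3 ^+ (e - 4 * k))^`() =
    (3 * e)%:R * ('X^(3 * k) * lin3 ^+ (e - 4 * k))
    + 3%:R * 'X^2 * (1 - 'X) * (k%:R * ('X^(3 * k.-1) * lin3 ^+ (e - 4 * k))).
  move=> ke; have ul : lin3 = 1 + 3%:R * 'X by rewrite /lin3 -polyC_natr.
  have du : lin3^`() = 3%:R.
    by rewrite ul derivD derivM derivX -!polyC_natr !derivC mul0r mulr1 !add0r.
  have dun n : lin3 * (lin3 ^+ n)^`() = (3 * n)%:R * lin3 ^+ n.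
    rewrite deriv_exp du; case: n => [|n]; rewrite ?muln0 ?mul0r ?mulr0 //.
    by rewrite -mulr_natr natrM exprS /=; ring.
  have dX : ('X^(3 * k))^`() = (3 * k)%:R * ('X^2 * 'X^(3 * k.-1)) :> {poly F}.
    rewrite derivXn -mulr_natl -exprD; case: k {ke} => [|k]; first by rewrite !mul0r.
    by congr (_ * 'X^_); lia.
  have e3 : (3 * k)%:R * 'X^(3 * k) = (3 * k)%:R * ('X^3 * 'X^(3 * k.-1)) :> {poly F}.
    rewrite -exprD; case: k {ke dX} => [|k]; first by rewrite !mul0r.
    by congr (_ * 'X^_); lia.
  transitivity (lin3 * ((3 * k)%:R * ('X^2 * 'X^(3 * k.-1))) * lin3 ^+ (e - 4 * k)
    + 'X^(3 * k) * (lin3 * (lin3 ^+ (e - 4 * k))^`())).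
    by rewrite derivM dX; ring.
  rewrite dun; move: (lin3 ^+ _) => U.
  transitivity (lin3 * ((3 * k)%:R * ('X^2 * 'X^(3 * k.-1))) * U
    + ((3 * e)%:R * 'X^(3 * k) - 4%:R * ((3 * k)%:R * 'X^(3 * k))) * U).
    by rewrite mulnBr natrB ?leq_pmul2l // !natrM; ring.
  by rewrite e3 ul !natrM; ring.
rewrite raddf_sum !mulr_sumr /=.
rewrite -!mulr_sumr.
have -> : lin3 * (\sum_(k < m.+1) (G`_k *: ('X^(3 * k) * lin3 ^+ (e - 4 * k)))^`())
  = \sum_(k < m.+1) ((3 * e)%:R * (G`_k *: ('X^(3 * k) * lin3 ^+ (e - 4 * k)))
    + 3%:R * 'X^2 * (1 - 'X) * (G`_k *: (k%:R * ('X^(3 * k.-1) * lin3 ^+ (e - 4 * k))))).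
  rewrite mulr_sumr; apply: eq_bigr => k _; rewrite derivZ -scalerAr dt.
    by rewrite scalerDr !scalerAr.
  by have := ltn_ord k; lia.
rewrite !mulr_sumr big_split /= [X in _ + X = _]big_ord_recl /=.
rewrite !(mul0r, scaler0, mulr0) add0r.
congr (_ + _); apply: eq_bigr => k _; rewrite coef_deriv.
rewrite -!mul_polyC polyCMn mulrnAl /bump /= add1n.
rewrite (_ : (e - 4 * k.+1 = e - 4 - 4 * k)%N); last by lia.
by rewrite -mulr_natl; ring.
Qed.

(** Homogenizing a Bezout relation between [G] and [H] in a large degree [M] shows that [C] divides
    (1+3X)^M, to which it is coprime. *)
Lemma pull_coprime G H e1 e2 (C : {poly F}) :
    (4 * (size G).-1 <= e1)%N -> (4 * (size H).-1 <= e2)%N -> coprimep G H ->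
  C %| pull e1 G -> C %| pull e2 H -> coprimep C lin3 -> size C = 1%N.
Proof.
move=> Ge He /Bezout_eq1_coprimepP[[a b] /= ab1] CG CH Cu.
pose M := (4 * (size a + size b) + e1 + e2)%N.
have aM : (4 * (size a).-1 <= M - e1)%N by rewrite /M; lia.
have bM : (4 * (size b).-1 <= M - e2)%N by rewrite /M; lia.
have e1M : (M - e1 + e1 = M)%N by rewrite /M; lia.
have e2M : (M - e2 + e2 = M)%N by rewrite /M; lia.
apply/eqP; rewrite -dvdp1 -(@Gauss_dvdpl _ 1 (lin3 ^+ M)) ?coprimep_expr //.
rewrite mul1r -pull1 -ab1 pullD.
have -> : pull M (a * G) = pull (M - e1) a * pull e1 G by rewrite -pullM ?e1M.
have -> : pull M (b * H) = pull (M - e2) b * pull e2 H by rewrite -pullM ?e2M.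
by rewrite dvdp_add // dvdp_mull.
Qed.

End Homogenization.

Definition quartic k := trinom (4 * k)%N k.

Lemma quartic_fact k : (quartic k * k`! ^ 4 = (4 * k)`!)%N.
Proof.
rewrite /quartic -(@trinom_fact (4 * k)%N k); last by lia.
rewrite (_ : (4 * k - 3 * k = k)%N); last by lia.
by ring.
Qed.

Lemma quartic_rec n : (n.+1 ^ 3 * quartic n.+1 =
  (256 * n ^ 3 + 384 * n ^ 2 + 176 * n + 24) * quartic n)%N.
Proof.
apply/eqP; rewrite -(@eqn_pmul2r (n.+1 * n`! ^ 4)); last first.
  by rewrite muln_gt0 expn_gt0 fact_gt0.
have e1 := quartic_fact n.+1; have e2 := quartic_fact n.
rewrite (_ : (4 * n.+1 = (4 * n).+4)%N) in e1; last by lia.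
rewrite !factS -e2 in e1; apply/eqP.
transitivity (quartic n.+1 * (n.+1 * n`!) ^ 4)%N; first by ring.
rewrite e1 -[(4 * n).+4]addn4 -[(4 * n).+3]addn3 -[(4 * n).+2]addn2.
by rewrite -[(4 * n).+1]addn1 -[n.+1]addn1; ring.
Qed.

(** * The polynomial A as a pull-back *)

Section AxiPull.
Variables (p : nat) (p_pr : prime p).
Local Notation F := 'F_p.

(** Upper negation applied to C(i-p, m), which agrees with C(i, m) modulo p; the proof goes by
    Pascal's rule. *)
Lemma binFp_neg i m : (i < p)%N -> (m < p)%N ->
  'C(i, m)%:R = (-1) ^+ m * 'C(p.-1 - i + m, m)%:R :> F.
Proof.
elim: i m => [|i IHi] [|m] ip mp; rewrite ?bin0 ?expr0 ?mul1r //.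
  have -> : (p.-1 - 0 + m.+1 = m + p * 1)%N by lia.
  rewrite -[X in 'C(_ + _, X)](addn0 m.+1) -[X in (m.+1 + X)%N](muln0 p).
  by rewrite bin_lucas ?bin0n ?(bin_small (ltnSn m)) ?mul0r ?mulr0 //; lia.
rewrite binS natrD !IHi ?(ltnW ip) ?(ltnW mp) //.
have -> : (p.-1 - i + m.+1 = (p.-1 - i.+1 + m.+1).+1)%N by lia.
rewrite binS natrD (_ : (p.-1 - i.+1 + m.+1 = p.-1 - i + m)%N); last by lia.
by rewrite exprS; ring.
Qed.

Lemma quartic_big k : (k < p)%N -> (p <= 4 * k)%N -> (quartic k)%:R = 0 :> F.
Proof.
move=> kp pk; have /eqP := congr1 (fun n => n%:R : F) (quartic_fact k).
have -> : (4 * k)`!%:R = 0 :> F.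
  by apply/eqP; rewrite natFp_eq0 // dvdn_fact // prime_gt0.
rewrite natrM natrX mulf_eq0 expf_eq0 /= (negPf (factFp_neq0 p_pr kp)) orbF.
by move/eqP.
Qed.

Definition quartic_poly : {poly F} := \poly_(k < p) (quartic k)%:R.

(** Modulo p the exponent p-1-4k imitates -1-4k: upper negation turns C(p-1-4k, n-3k) into C(n+k,
    4k) up to sign. The summands with 4k < p have degree at most p-1-k, and the others vanish. *)
Lemma A_xi_sum : A_xi p =
  \sum_(0 <= k < p) (quartic k)%:R *: ('X^(3 * k) * lin3 F ^+ (p.-1 - 4 * k)).
Proof.
have p0 := prime_gt0 p_pr.
apply/polyP => n; rewrite coef_poly coef_sum.
case: ltnP => np.
  rewrite (xiE _ np); apply: eq_big_nat => k /andP[_ kp].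
  rewrite coefZ coefXnM; case: ltnP => nk.
    by rewrite xi_term_small // mulr0.
  rewrite coef_lin3X /xi_term.
  rewrite -(mulrA (_ * _)) -natrM trinom_bin // natrM -/(quartic k).
  have [k4|k4] := ltnP (4 * k)%N p; last by rewrite quartic_big // !(mul0r, mulr0).
  rewrite (@binFp_neg (p.-1 - 4 * k)%N); [|lia|lia].
  rewrite -(@bin_sub (n + k)%N (4 * k)%N); last by lia.
  rewrite (_ : (n + k - 4 * k = n - 3 * k)%N); last by lia.
  rewrite (_ : (p.-1 - (p.-1 - 4 * k) + (n - 3 * k) = n + k)%N); last by lia.
  have -> : (-1) ^+ (n - k) = (-1) ^+ (n - 3 * k) :> F.
    rewrite (_ : (n - k = n - 3 * k + k * 2)%N); last by lia.
    by rewrite exprD exprM sqrr_sign mulr1.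
  by ring.
rewrite big_nat big1 // => k /andP[_ kp].
have [k4|k4] := ltnP (4 * k)%N p; last by rewrite quartic_big // scale0r coef0.
rewrite coefZ coefXnM; case: ltnP => nk; first by rewrite mulr0.
by rewrite coef_lin3X bin_small ?mul0r ?mulr0 //; lia.
Qed.

Lemma A_xi_pull : A_xi p = pull p.-1 quartic_poly.
Proof.
rewrite A_xi_sum (pull_wide _ (size_poly _ _)) big_mkord.
by apply: eq_bigr => k _; rewrite coef_poly ltn_ord.
Qed.

End AxiPull.

(** * Truncated Clausen formula *)

(** Locked so that its iterates behave as independent unknowns in the algebra below. *)
HB.lock Definition theta (R : comNzRingType) (q : {poly R}) : {poly R} :=
  'X * q^`().

Section Theta.
Variable R : comNzRingType.
Implicit Types q : {poly R}.

Lemma coef_theta q n : (theta q)`_n = n%:R * q`_n.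
Proof.
rewrite theta.unlock coefXM; case: n => [|n] /=; rewrite ?mul0r //.
by rewrite coef_deriv mulr_natl.
Qed.

Lemma thetaD q1 q2 : theta (q1 + q2) = theta q1 + theta q2.
Proof. by rewrite theta.unlock derivD mulrDr. Qed.

Lemma thetaM q1 q2 : theta (q1 * q2) = theta q1 * q2 + q1 * theta q2.
Proof. by rewrite theta.unlock derivM; ring. Qed.

Lemma theta_nat n : theta (n%:R : {poly R}) = 0.
Proof. by rewrite theta.unlock -polyC_natr derivC mulr0. Qed.

Lemma theta0 : theta (0 : {poly R}) = 0.
Proof. by rewrite theta.unlock deriv0 mulr0. Qed.

Lemma theta1 : theta (1 : {poly R}) = 0.
Proof. by rewrite theta.unlock derivC mulr0. Qed.

Lemma thetaX : theta 'X = 'X :> {poly R}.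
Proof. by rewrite theta.unlock derivX mulr1. Qed.

Lemma thetaN q : theta (- q) = - theta q.
Proof. by rewrite theta.unlock derivN mulrN. Qed.

Definition thetaE := (theta_nat, thetaX, thetaD, thetaM, thetaN).

End Theta.

Section Clausen.
Variable R : comNzRingType.
Implicit Types P : {poly R}.

(* theta^3 P = 256 X (theta + 1/4) (theta + 1/2) (theta + 3/4) P, whose solution
   in Q[[X]] with constant term 1 is sum_k (4k)!/k!^4 X^k *)
Definition ode3 P :=
  theta (theta (theta P)) = 'X * (256%:R * theta (theta (theta P))
    + 384%:R * theta (theta P) + 176%:R * theta P + 24%:R * P).

(** The hypothesis is the equation of 2F1(1/8,3/8;1;256X), and [ode3] is its symmetric square. *)
Lemma clausen13 P :
  theta (theta P) = 'X * (256%:R * theta (theta P) + 128%:R * theta P + 12%:R * P) ->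
  ode3 (P ^+ 2).
Proof.
move=> h2; have h3 := congr1 (@theta R) h2; rewrite /ode3 expr2.
rewrite !thetaE in h3; rewrite !thetaE.
move: h2 h3; move: (theta (theta (theta P))) (theta (theta P)) (theta P).
move=> P3 P2 P1 /eqP; rewrite -subr_eq0 => /eqP h2 /eqP.
rewrite -subr_eq0 => /eqP h3; apply/eqP; rewrite -subr_eq0; apply/eqP.
(* the new equation is a combination of the given one and its derivative *)
have := congr2 +%R (congr1 ( *%R (6%:R * P1)) h2) (congr1 ( *%R (2%:R * P)) h3).
rewrite !mulr0 addr0 => <-; ring.
Qed.

(** Here the hypothesis is the equation of 2F1(5/8,7/8;1;256X). *)
Lemma clausen57 P :
  theta (theta P) = 'X * (256%:R * theta (theta P) + 384%:R * theta P + 140%:R * P) ->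
  ode3 ((1 - 256%:R * 'X) * P ^+ 2).
Proof.
set w : {poly R} := 1 - 256%:R * 'X.
have thw : theta w = - (256%:R * 'X).
  rewrite /w thetaD theta1 thetaN thetaM theta_nat thetaX; ring.
move=> h2; have h3 := congr1 (@theta R) h2; rewrite /ode3 expr2.
rewrite !thetaE in h3; rewrite !(thw, thetaE).
move: h2 h3; move: (theta (theta (theta P))) (theta (theta P)) (theta P).
move=> P3 P2 P1 /eqP; rewrite -subr_eq0 => /eqP h2 /eqP.
rewrite -subr_eq0 => /eqP h3; apply/eqP; rewrite -subr_eq0; apply/eqP.
(* These are the multipliers of [clausen13] times [w], the first one corrected by
   [4 * theta w * P]. *)
have := congr2 +%R (congr1 ( *%R (6%:R * w * P1 - 1024%:R * 'X * P)) h2)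
  (congr1 ( *%R (2%:R * w * P)) h3).
by rewrite !mulr0 addr0 => h; rewrite -[RHS]h theta0 /w; ring.
Qed.

End Clausen.

(** * Terminating hypergeometric polynomials *)

Section Hypergeometric.
Variables (p : nat) (p_pr : prime p).
Local Notation F := 'F_p.
Variables (r s N : nat).
Hypothesis (Np : (N < p)%N).
Hypothesis (N0 : ((8 * N + r) * (8 * N + s))%:R = 0 :> F).

(* 2F1(r/8, s/8; 1; 256 X), which terminates at degree N by N0 *)
Definition hypgeom : {poly F} := \poly_(n < N.+1)
  \prod_(0 <= i < n) ((4 * ((8 * i + r) * (8 * i + s)))%:R / i.+1%:R ^+ 2).

Lemma hypgeom0 : hypgeom`_0 = 1.
Proof. by rewrite coef_poly /= big_geq. Qed.

Lemma size_hypgeom : (size hypgeom <= N.+1)%N.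
Proof. exact: size_poly. Qed.

Lemma hypgeom_rec n : n.+1%:R ^+ 2 * hypgeom`_n.+1 =
  (4 * ((8 * n + r) * (8 * n + s)))%:R * hypgeom`_n.
Proof.
(* At [n = N] the right side vanishes by [N0]; beyond [N] both coefficients are zero. *)
rewrite !coef_poly !ltnS; case: (ltngtP n N) => [nN|Nn|->].
- rewrite big_nat_recr //= mulrCA mulrC; congr (_ * _).
  by rewrite mulrC divfK // expf_neq0 // natFp_neq0 //; lia.
- by rewrite !mulr0.
- by rewrite mulr0 natrM N0 mulr0 mul0r.
Qed.

Lemma theta_hypgeom : theta (theta hypgeom) =
  'X * (256%:R * theta (theta hypgeom) + (32 * (r + s))%:R * theta hypgeom
        + (4 * (r * s))%:R * hypgeom).
Proof.
apply/polyP => -[|n]; rewrite coefXM !coef_theta /= ?mul0r //.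
rewrite !coefD -!polyC_natr !coefCM !coef_theta.
have := hypgeom_rec n; rewrite expr2 -mulrA => ->.
by rewrite !(natrM, natrD); ring.
Qed.

(** Differentiating a hypergeometric equation raises all its parameters by 1, so the singular points
    stay 0 and 1/256. The base case is [theta_hypgeom] with a factor X cancelled. *)
Lemma hypgeom_ode j : ('X - 256%:R * ('X * 'X)) * hypgeom^`(j.+2) +
    (j.+1%:R - (512 * j + 256 + 32 * (r + s))%:R * 'X) * hypgeom^`(j.+1)
  = (4 * ((8 * j + r) * (8 * j + s)))%:R * hypgeom^`(j).
Proof.
elim: j => [|j IHj].
  have := theta_hypgeom; rewrite theta.unlock derivM derivX mul1r.
  move/(mulfI (negbT (polyX_eq0 F)))/eqP; rewrite -subr_eq0 => /eqP h.
  apply/eqP; rewrite -subr_eq0 derivnS derivn1 derivn0; apply/eqP.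
  by rewrite -[RHS]h; ring.
have dnat n : (n%:R : {poly F})^`() = 0 by rewrite -polyC_natr derivC.
have := congr1 (@deriv F) IHj.
rewrite !(dnat, derivX, derivM, derivD, derivN) -!derivnS => /eqP.
rewrite -subr_eq0 => /eqP h; apply/eqP; rewrite -subr_eq0.
by apply/eqP; rewrite -[RHS]h; ring.
Qed.

Lemma hypgeom_lead : (forall i, (i < N)%N -> ((8 * i + r) * (8 * i + s))%:R != 0 :> F) ->
  4%:R != 0 :> F -> hypgeom`_N != 0.
Proof.
move=> nz nz4; rewrite coef_poly ltnSn prodf_seq_neq0.
apply/allP => i; rewrite mem_index_iota => /andP[_ iN].
rewrite natrM mulf_neq0 ?mulf_neq0 ?nz // invr_neq0 // expf_neq0 //.
by rewrite natFp_neq0 //; lia.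
Qed.

End Hypergeometric.

Section Truncation.
Variables (p : nat) (p_pr : prime p).
Local Notation F := 'F_p.

(** On coefficients the equation is the recurrence [quartic_rec], whose leading factor (n+1)^3 is
    invertible while n+1 < p. *)
Lemma ode3_quartic_poly (g : {poly F}) : (size g <= p)%N -> g`_0 = 1 -> ode3 g ->
  quartic_poly p = g.
Proof.
move=> gp g0 og; apply/polyP => n; rewrite coef_poly.
case: ltnP => [|pn]; last by rewrite nth_default // (leq_trans gp).
elim: n => [|n IHn] np; first by rewrite g0.
have nz : n.+1%:R ^+ 3 != 0 :> F by rewrite expf_neq0 // natFp_neq0.
apply: (mulfI nz); rewrite -natrX -natrM quartic_rec natrM IHn ?(ltnW np) //.
have /= := congr1 (fun q : {poly F} => q`_n.+1) og.
rewrite coefXM /= !coefD -!polyC_natr !coefCM !coef_theta => e.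
transitivity (n.+1%:R * (n.+1%:R * (n.+1%:R * g`_n.+1))); last by rewrite natrX; ring.
by rewrite e !(natrM, natrD, natrX); ring.
Qed.

Lemma quartic_poly13 N : ((8 * N).+1 == p) || ((8 * N).+3 == p) ->
  quartic_poly p = hypgeom p 1 3 N ^+ 2.
Proof.
move=> Np; have p1 := prime_gt1 p_pr.
have NN : (N < p)%N by lia.
have N0 : ((8 * N + 1) * (8 * N + 3))%:R = 0 :> F.
  apply/eqP; rewrite natFp_eq0 // addn1 addn3.
  by case/orP: Np => /eqP ->; [rewrite dvdn_mulr | rewrite dvdn_mull].
apply: ode3_quartic_poly.
- have := size_polyMleq (hypgeom p 1 3 N) (hypgeom p 1 3 N).
  by rewrite expr2; have := size_hypgeom p 1 3 N; lia.
- by rewrite expr2 coefM big_ord1 subn0 hypgeom0 mulr1.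
- exact/clausen13/theta_hypgeom.
Qed.

Lemma quartic_poly57 N : ((8 * N + 5)%N == p) || ((8 * N + 7)%N == p) ->
  quartic_poly p = (1 - 256%:R * 'X) * hypgeom p 5 7 N ^+ 2.
Proof.
move=> Np; have p1 := prime_gt1 p_pr.
have NN : (N < p)%N by lia.
have N0 : ((8 * N + 5) * (8 * N + 7))%:R = 0 :> F.
  apply/eqP; rewrite natFp_eq0 //.
  by case/orP: Np => /eqP ->; [rewrite dvdn_mulr | rewrite dvdn_mull].
apply: ode3_quartic_poly.
- have sQ : (size (hypgeom p 5 7 N ^+ 2) <= (2 * N).+1)%N.
    rewrite expr2 (leq_trans (size_polyMleq _ _)) //.
    by have := size_hypgeom p 5 7 N; lia.
  have sw : (size (1 - 256%:R * 'X : {poly F})%R <= 2)%N.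
    apply/leq_sizeP => -[|[|j]] // _.
    by rewrite coefB coef1 coefMX -polyC_natr coefC subr0.
  rewrite (leq_trans (size_polyMleq _ _)) // -subn1 leq_subLR.
  by rewrite (leq_trans (leq_add sw sQ)) //; lia.
- rewrite coefM big_ord1 subn0 expr2 coefM big_ord1 subn0 hypgeom0 !mulr1.
  by rewrite coefB coefMX coef1 subr0.
- exact/clausen57/theta_hypgeom.
Qed.

End Truncation.

(** * Multiplicities of the factors of A *)

Lemma coprimep_sing (K : fieldType) (q : {poly K}) : 256%:R != 0 :> K ->
  coprimep q (1 - 256%:R * 'X) = (q.[256%:R^-1] != 0).
Proof.
move=> n256.
have -> : 1 - 256%:R * 'X = (- 256%:R) *: ('X - (256%:R^-1)%:P) :> {poly K}.
  rewrite scalerBr -!mul_polyC -polyCM mulNr (mulfV n256) !polyCN polyC1.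
  by rewrite polyC_natr; ring.
by rewrite coprimepZr ?oppr_eq0 // coprimep_XsubC.
Qed.

Lemma hypgeom_ode_coef_sing (K : fieldType) j r s (z : K) : 256%:R * z = 1 ->
  8%:R * (j.+1%:R - (512 * j + 256 + 32 * (r + s))%:R * z) =
  - (8 * j + r + s)%:R.
Proof.
move=> zE.
transitivity (8%:R * j.+1%:R - (16 * j + 8 + (r + s))%:R * (256%:R * z)); first by ring.
by rewrite zE; ring.
Qed.

(** * Separability of the hypergeometric polynomials *)

Section HypRoots.
Variables (p : nat) (p_pr : prime p) (p_odd : odd p).
Local Notation F := 'F_p.

Lemma pow2Fp_neq0 k : (2 ^ k)%:R != 0 :> F.
Proof.
rewrite natrX expf_neq0 // natFp_eq0 // dvdn_prime2 //.
by apply/eqP => p2; move: p_odd; rewrite p2.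
Qed.

Variables (r s N : nat).
Hypothesis (Np : (N < p)%N).
Hypothesis (N0 : ((8 * N + r) * (8 * N + s))%:R = 0 :> F).
Hypothesis (Nlt : forall i, (i < N)%N -> ((8 * i + r) * (8 * i + s))%:R != 0 :> F).
Hypothesis (Nsum : forall i, (i < N)%N -> (8 * i + r + s)%:R != 0 :> F).
Local Notation P := (hypgeom p r s N).

Let P_N : P`_N != 0.
Proof. by apply: hypgeom_lead => //; rewrite (_ : 4 = 2 ^ 2)%N // pow2Fp_neq0. Qed.

Let n256 : 256%:R != 0 :> F.
Proof. by rewrite (_ : 256 = 2 ^ 8)%N // pow2Fp_neq0. Qed.

Let derivn_top : P^`(N) = (N`!%:R * P`_N)%:P.
Proof.
apply/polyP => i; rewrite coef_derivn coefC; case: i => [|i] /=.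
  by rewrite addn0 ffactnn mulr_natl.
by rewrite coef_poly ifF ?mul0rn //; lia.
Qed.

(** At 1/256 the second-order term of [hypgeom_ode] drops out, and [Nsum] makes the next coefficient
    nonzero. A zero there would thus pass to all derivatives up to the N-th, a nonzero constant. *)
Lemma hypgeom_nonroot : P.[256%:R^-1] != 0.
Proof.
apply/negP => /eqP P0; set z : F := 256%:R^-1 in P0.
have zE : 256%:R * z = 1 by rewrite mulfV.
suff all0 j : (j <= N)%N -> P^`(j).[z] = 0.
  have := all0 N (leqnn N); rewrite derivn_top hornerC => /eqP.
  by rewrite mulf_eq0 (negPf P_N) (negPf (factFp_neq0 p_pr Np)).
elim: j => [|j IHj] jN //.
have := congr1 (fun q : {poly F} => 8%:R * q.[z]) (hypgeom_ode p_pr Np N0 j).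
rewrite !(hornerM, hornerD, hornerN, hornerX, =^~ polyC_natr, hornerC).
rewrite IHj ?(ltnW jN) // !mulr0.
have -> : z - 256%:R * (z * z) = 0 by rewrite mulrA zE mul1r subrr.
rewrite mul0r add0r mulrA => /eqP; rewrite mulf_eq0 => /orP[|/eqP //].
rewrite (hypgeom_ode_coef_sing _ _ _ zE).
by rewrite oppr_eq0 (negPf (Nsum jN)).
Qed.

Lemma hypgeom_coprime_sing : coprimep P ('X - 256%:R * ('X * 'X)).
Proof.
have -> : 'X - 256%:R * ('X * 'X) = ('X - 0%:P) * (1 - 256%:R * 'X) :> {poly F}.
  by rewrite polyC0 subr0; ring.
rewrite coprimepMr coprimep_XsubC /root horner_coef0 hypgeom0 oner_eq0 /=.
by rewrite (coprimep_sing _ n256) hypgeom_nonroot.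
Qed.

Lemma hypgeom_coprime_deriv : coprimep P P^`().
Proof.
set G := gcdp P P^`().
have Gsing : coprimep G ('X - 256%:R * ('X * 'X)).
  by apply: coprimep_dvdr hypgeom_coprime_sing; rewrite dvdp_gcdl.
have Gall j : G %| P^`(j) /\ G %| P^`(j.+1).
  elim: j => [|j [Gj Gj1]]; first by rewrite derivn0 derivn1 dvdp_gcdl dvdp_gcdr.
  split=> //; rewrite -(Gauss_dvdpr _ Gsing).
  move: (hypgeom_ode p_pr Np N0 j) => /(canRL (addrK _)) ->.
  by rewrite dvdp_sub // dvdp_mull.
have [GN _] := Gall N.
have cN : N`!%:R * P`_N != 0 by rewrite mulf_neq0 ?factFp_neq0.
rewrite derivn_top in GN.
have := dvdp_leq _ GN; rewrite polyC_eq0 cN size_polyC cN => /(_ isT) Gs.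
rewrite /coprimep -/G eqn_leq Gs lt0n size_poly_eq0 gcdp_eq0.
apply/negP => /andP[/eqP P0 _]; move: P_N; rewrite P0 coef0 eqxx //.
Qed.

End HypRoots.

(** * Factorization of A in the two cases *)

Section Factorization.
Variables (p : nat) (p_pr : prime p) (p_odd : odd p).
Local Notation F := 'F_p.
Local Notation u := (lin3 F).

Let n256 : 256%:R != 0 :> F := pow2Fp_neq0 p_pr p_odd 8.

Let wz : {poly F} := 1 - 256%:R * 'X.

Let n3 : p <> 3 -> 3%:R != 0 :> F.
Proof. by move=> p3; rewrite natFp_eq0 // dvdn_prime2 //; apply/eqP. Qed.

Let oneBX : 1 - 'X = -1 *: ('X - 1%:P) :> {poly F}.
Proof. by rewrite scaleN1r opprB polyC1. Qed.

Lemma pull_at1 e (G : {poly F}) : (4 * (size G).-1 <= e)%N ->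
  (pull e G).[1] = 4%:R ^+ e * G.[256%:R^-1].
Proof.
move=> Ge; have e4 : 1 + 3%:R * 1 = 4%:R :> F by ring.
rewrite horner_pull // e4 ?(pow2Fp_neq0 p_pr p_odd 2) // expr1n mul1r.
by rewrite -(natrX _ 4 4).
Qed.

Lemma pull_at0 e (G : {poly F}) : (4 * (size G).-1 <= e)%N ->
  (pull e G).[0] = G`_0.
Proof.
move=> Ge; rewrite horner_pull // mulr0 addr0 ?oner_neq0 // !expr1n mul1r.
by rewrite expr0n mul0r horner_coef0.
Qed.

(** At the zero -1/3 of 1+3X only the top term [k = N] survives. *)
Lemma pull_at_pole N (G : {poly F}) : p <> 3 -> (size G <= N.+1)%N ->
  (pull (4 * N) G).[- 3%:R^-1] = G`_N * (- 3%:R^-1) ^+ (3 * N).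
Proof.
move=> p3 GN; rewrite (pull_wide _ GN) horner_sum big_ord_recr /= subnn expr0.
rewrite mulr1 hornerZ hornerXn big1 ?add0r // => k _.
have u0 : u.[- 3%:R^-1] = 0 by rewrite !hornerE mulrN mulfV ?n3 // subrr.
rewrite hornerZ hornerM (horner_exp u) u0 expr0n.
by rewrite (_ : (4 * N - 4 * k == 0)%N = false) ?mulr0 //; have := ltn_ord k; lia.
Qed.

Lemma lin3_factor : p <> 3 -> u = 3%:R *: ('X - (- 3%:R^-1)%:P).
Proof.
move=> p3; rewrite scalerBr -!mul_polyC -polyCM mulrN mulfV ?n3 //.
by rewrite polyCN polyC1 opprK addrC.
Qed.

Lemma coprimep_lin3 (C : {poly F}) : p <> 3 ->
  coprimep C u = (C.[- 3%:R^-1] != 0).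
Proof. by move=> p3; rewrite lin3_factor // coprimepZr ?n3 // coprimep_XsubC. Qed.

Section Case13.
Variable N : nat.
Hypothesis Np : ((8 * N).+1 == p) || ((8 * N).+3 == p).
Local Notation P := (hypgeom p 1 3 N).

Let p1 : (1 < p)%N := prime_gt1 p_pr.
Let NN : (N < p)%N. Proof. by lia. Qed.
Let N0 : ((8 * N + 1) * (8 * N + 3))%:R = 0 :> F.
Proof.
apply/eqP; rewrite natFp_eq0 // addn1 addn3.
by case/orP: Np => /eqP ->; [rewrite dvdn_mulr | rewrite dvdn_mull].
Qed.
Let Nlt i : (i < N)%N -> ((8 * i + 1) * (8 * i + 3))%:R != 0 :> F.
Proof. by move=> iN; rewrite natrM mulf_neq0 // natFp_neq0 //; lia. Qed.
Let Nsum i : (i < N)%N -> (8 * i + 1 + 3)%:R != 0 :> F.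
Proof.
move=> iN; rewrite (_ : 8 * i + 1 + 3 = 2 ^ 2 * (2 * i + 1))%N; last by lia.
by rewrite natrM mulf_neq0 ?pow2Fp_neq0 // natFp_neq0 //; lia.
Qed.
Let sP : (4 * (size P).-1 <= 4 * N)%N.
Proof. by have := size_hypgeom p 1 3 N; lia. Qed.

Lemma A_xi_13 : A_xi p = pull p./2 P ^+ 2.
Proof.
have p2 : (p.-1 = p./2 + p./2)%N.
  by have := odd_double_half p; rewrite p_odd -addnn; lia.
have le4 : (4 * (size P).-1 <= p./2)%N by lia.
by rewrite A_xi_pull // (quartic_poly13 p_pr Np) !expr2 p2 pullM.
Qed.

Lemma pull13_squarefree (C : {poly F}) : C ^+ 2 %| pull p./2 P -> size C = 1%N.
Proof.
(* [N = 0] means [p = 3], where 1+3X is 1 and the pull-back is 1. *)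
have [N0'|N_gt0] := posnP N.
  have P1 : P = 1.
    by rewrite /hypgeom N0' poly_def big_ord1 big_geq // scale1r.
  have u1 : u = 1.
    rewrite /lin3 (_ : 3%:R = 0) ?polyC0 ?mul0r ?addr0 //.
    by apply/eqP; rewrite natFp_eq0 //; lia.
  rewrite P1 pull1 u1 expr1n => C1; apply/eqP; rewrite -dvdp1.
  by apply: dvdp_trans C1; rewrite dvdp_exp.
have p3 : p <> 3 by lia.
have PN : P`_N != 0 by apply: hypgeom_lead => //; apply: (pow2Fp_neq0 p_pr p_odd 2).
set B := pull (4 * N) P.
have Bpole : B.[- 3%:R^-1] != 0.
  rewrite pull_at_pole ?size_hypgeom // mulf_neq0 // expf_neq0 // oppr_eq0.
  by rewrite invr_eq0 n3.
suff main : C ^+ 2 %| B -> size C = 1%N.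
  (* For p = 8N+3 the exponent p/2 is 4N+1: one more factor 1+3X appears, and it is simple because
     [B] does not vanish at -1/3. *)
  have [/eqP p8|] := orP Np; first by rewrite (_ : p./2 = 4 * N)%N //; lia.
  move=> p8; have -> : pull p./2 P = u * B.
    rewrite -(mul1r P) (_ : p./2 = 1 + 4 * N)%N ?pullM ?size_poly1 ?pull1 //.
    by lia.
  move=> C2uB; apply: main; rewrite -(Gauss_dvdpr _ (_ : coprimep _ u)) //.
  rewrite coprimep_expl // coprimep_lin3 //; apply/negP => C0.
  case/negP: Bpole; rewrite -/(root _ _) -dvdp_XsubCl.
  have : ('X - (- 3%:R^-1)%:P) ^+ 2 %| u * B.
    by apply: dvdp_trans C2uB; rewrite dvdp_exp2r // dvdp_XsubCl.
  rewrite lin3_factor // -scalerAl dvdpZr ?n3 // expr2 dvdp_mul2l //.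
  by rewrite polyXsubC_eq0.
move=> C2B; have CB : C %| B by apply: dvdp_trans C2B; rewrite dvdp_exp.
have CB' : C %| B^`().
  case/dvdpP: C2B => R ->; rewrite expr2 !derivM.
  by apply: dvdp_add; apply: dvdp_mull; rewrite ?dvdp_mulIl //
    dvdp_add ?dvdp_mulIl ?dvdp_mulIr.
have root_free x : B.[x] != 0 -> coprimep C ('X - x%:P).
  move=> Bx; apply: (coprimep_dvdr CB); rewrite coprimep_XsubC.
  exact: Bx.
have cu : coprimep C u by rewrite lin3_factor // coprimepZr ?n3 ?root_free.
(* By the chain rule [C] divides the term in P'. It is coprime to X and 1-X because P(0) = 1 and
   P(1/256) is nonzero, so it divides the pull-backs of the coprime P and P'. *)
have C3 : C %| 3%:R * 'X^2 * (1 - 'X) * pull (4 * N - 4) P^`().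
  have : C %| u * B^`() - (3 * (4 * N))%:R * B by rewrite dvdp_sub // dvdp_mull.
  by rewrite (deriv_pull sP) addrC addKr.
move: C3; rewrite -mulrA Gauss_dvdpr; last first.
  rewrite -polyC_natr mul_polyC coprimepZr ?n3 // coprimep_expr //.
  rewrite -['X]subr0 -polyC0 root_free // pull_at0 // hypgeom0.
  exact: oner_neq0.
rewrite Gauss_dvdpr; last first.
  rewrite oneBX coprimepZr ?oppr_eq0 ?oner_neq0 // root_free // pull_at1 // mulf_neq0 //.
    by rewrite expf_neq0 // (pow2Fp_neq0 p_pr p_odd 2).
  exact: hypgeom_nonroot.
move=> CE; apply: pull_coprime CB CE cu => //.
  have Pn0 : P != 0 by apply/eqP => P0; move: PN; rewrite P0 coef0 eqxx.
  have : (size P^`() <= N)%N.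
    by rewrite -ltnS (leq_trans (lt_size_deriv Pn0)) ?size_hypgeom.
  by move: (size _) => m mN; clear -mN; lia.
exact: hypgeom_coprime_deriv.
Qed.
End Case13.

Section Case57.
Variable N : nat.
Hypothesis Np : ((8 * N + 5)%N == p) || ((8 * N + 7)%N == p).
Local Notation Q := (hypgeom p 5 7 N).
Local Notation D := (81%:P * 'X^2 + 14%:P * 'X + 1 : {poly F}).

Let p1 : (1 < p)%N := prime_gt1 p_pr.
Let NN : (N < p)%N. Proof. by lia. Qed.
Let p3 : p <> 3. Proof. by lia. Qed.
Let N0 : ((8 * N + 5) * (8 * N + 7))%:R = 0 :> F.
Proof.
apply/eqP; rewrite natFp_eq0 //.
by case/orP: Np => /eqP ->; [rewrite dvdn_mulr | rewrite dvdn_mull].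
Qed.
Let Nlt i : (i < N)%N -> ((8 * i + 5) * (8 * i + 7))%:R != 0 :> F.
Proof. by move=> iN; rewrite natrM mulf_neq0 // natFp_neq0 //; lia. Qed.
Let Nsum i : (i < N)%N -> (8 * i + 5 + 7)%:R != 0 :> F.
Proof.
move=> iN; rewrite (_ : 8 * i + 5 + 7 = 2 ^ 2 * (2 * i + 3))%N; last by lia.
by rewrite natrM mulf_neq0 ?pow2Fp_neq0 // natFp_neq0 //; lia.
Qed.
(** Chosen so that p-1 = 4 + 2e: weight 4 goes to 1-256X and e to each factor [Q]. *)
Let e := ((p - 5)./2)%N.
Let sQ : (4 * (size Q).-1 <= e)%N.
Proof. by have := size_hypgeom p 5 7 N; rewrite /e; lia. Qed.
Let Qz : Q.[256%:R^-1] != 0. Proof. exact: hypgeom_nonroot. Qed.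

Let sw : (size wz <= 2)%N.
Proof.
apply/leq_sizeP => -[|[|j]] // _.
by rewrite coefB coef1 coefMX -polyC_natr coefC subr0.
Qed.

Let sw4 : (4 * (size wz).-1 <= 4)%N.
Proof. by move: sw; case: (size wz) => [|[|[]]]. Qed.

Let DE : D = 81%:R * 'X^2 + 14%:R * 'X + 1.
Proof. by rewrite -!polyC_natr. Qed.

Let pull_wz : pull 4 wz = (1 - 'X) ^+ 2 * D.
Proof.
have [w0 w1] : wz`_0 = 1 /\ wz`_1 = - 256%:R.
  rewrite !coefB !coef1 !coefMX -polyC_natr !coefC /=.
  by rewrite subr0 sub0r.
rewrite (pull_wide _ sw) !big_ord_recl big_ord0 /= w0 w1.
rewrite muln0 subn0 expr0 mul1r expr0 mulr1 addr0 scale1r.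
by rewrite DE -mul_polyC polyCN /lin3 !polyC_natr; ring.
Qed.

Lemma A_xi_57 : A_xi p = D * ((1 - 'X) * pull e Q) ^+ 2.
Proof.
have e2 : (p.-1 = 4 + (e + e))%N.
  by have := odd_double_half p; rewrite p_odd -addnn /e; lia.
have sQ2 : (4 * (size (Q * Q)%R).-1 <= e + e)%N.
  by have := size_polyMleq Q Q; lia.
rewrite A_xi_pull // (quartic_poly57 p_pr Np) -/wz expr2 e2 pullM //.
by rewrite pullM // pull_wz; ring.
Qed.

(** If d >= 2, the quadratic [D], being coprime to its cofactor in A, would divide D'^2, but its
    discriminant is a unit. *)
Lemma A_xi_57_not_power (C : {poly F}) d : A_xi p = C ^+ d -> (d <= 1)%N.
Proof.
move=> AC; rewrite leqNgt; apply/negP => d1.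
have n3' : 3%:R != 0 :> F by exact: n3.
have cDu : coprimep D u.
  rewrite coprimep_lin3 // DE; set x : F := - 3%:R^-1.
  have -> : (81%:R * 'X^2 + 14%:R * 'X + 1 : {poly F}).[x] = (2 ^ 4)%:R / 3%:R.
    rewrite -!polyC_natr -polyC1 !(hornerD, hornerM, hornerXn, hornerX, hornerC).
    rewrite /x natrX; field.
    exact: n3'.
  by rewrite mulf_neq0 ?invr_eq0 ?pow2Fp_neq0.
have cD1 : coprimep D (1 - 'X).
  rewrite oneBX coprimepZr ?oppr_eq0 ?oner_neq0 // coprimep_XsubC /root DE.
  have -> : (81%:R * 'X^2 + 14%:R * 'X + 1 : {poly F}).[1] = (2 ^ 5)%:R * 3%:R.
    by rewrite -!polyC_natr -polyC1 !(hornerD, hornerM, hornerXn, hornerX, hornerC)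
      natrX; ring.
  by rewrite mulf_neq0 ?pow2Fp_neq0.
(* [D] divides the pull-back of [wz], and [wz] is coprime to [Q] because [Q] does not vanish at
   1/256. *)
have cDQ : coprimep D (pull e Q).
  apply/eqP; apply: (@pull_coprime F wz Q 4 e).
  - exact: sw4.
  - exact: sQ.
  - by rewrite coprimep_sym (coprimep_sing _ n256).
  - by rewrite pull_wz dvdp_mull // dvdp_gcdl.
  - exact: dvdp_gcdr.
  - by apply: coprimep_dvdr cDu; rewrite dvdp_gcdl.
have AE := A_xi_57; set B := _ * pull e Q in AE.
have cDB : coprimep D B by rewrite coprimepMr cD1.
have CA : C ^+ d.-1 %| (A_xi p)^`().
  by rewrite AC deriv_exp -mulr_natl dvdp_mull // dvdp_mull.
(* C^d divides (C^(d-1))^2, hence the square of the derivative of C^d. *)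
have DA2 : D %| (A_xi p)^`() ^+ 2.
  apply: (@dvdp_trans _ (C ^+ d)); first by rewrite -AC AE dvdp_mulIl.
  apply: (@dvdp_trans _ ((C ^+ d.-1) ^+ 2)); last exact: dvdp_exp2r.
  by rewrite -exprM dvdp_exp2l //; clear -d1; lia.
have dD : D^`() = 162%:R * 'X + 14%:R.
  rewrite DE -!polyC_natr -polyC1 !(derivC, derivX, derivD, derivM).
  by rewrite ?polyC1 !polyC_natr; ring.
have : D %| D^`() ^+ 2.
  have A' : (A_xi p)^`() = D^`() * B ^+ 2 + D * (B ^+ 2)^`() by rewrite AE derivM.
  have : D %| (D^`() ^+ 2) * (B ^+ 2) ^+ 2.
    have -> : (D^`() ^+ 2) * (B ^+ 2) ^+ 2 = (A_xi p)^`() ^+ 2 -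
       D * ((B ^+ 2)^`() * (D * (B ^+ 2)^`() + 2%:R * (D^`() * B ^+ 2))).
      by rewrite A'; ring.
    by rewrite dvdp_sub // dvdp_mulIl.
  by rewrite Gauss_dvdpl // !coprimep_expr.
rewrite dD => D2.
(* 4 * 81 * D - D'^2 is the opposite of the discriminant 14^2 - 4 * 81 = -128. *)
have D128 : D %| ((2 ^ 7)%:R : F)%:P.
  have -> : ((2 ^ 7)%:R : F)%:P = D * 324%:R - (162%:R * 'X + 14%:R) ^+ 2.
    by rewrite DE polyC_natr natrX; ring.
  by rewrite dvdp_sub // dvdp_mulIl.
have := dvdp_leq _ D128; rewrite polyC_eq0 size_polyC pow2Fp_neq0 // => /(_ isT).
apply/negP; rewrite -ltnNge ltnW //.
rewrite ltnNge; apply/negP => /leq_sizeP/(_ 2 (leqnn _))/eqP.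
rewrite !coefD !coefCM coefXn coefX coef1 /= !(mulr0, mulr1, addr0).
by rewrite (_ : 81 = 3 ^ 4)%N // natrX expf_eq0 /= (negPf n3').
Qed.
End Case57.
End Factorization.

(** * Kummer extensions *)

Section GroundField.
Variables (L : fieldType) (K : {pred L}).

(* K(1) is K itself; going through adjoin provides its field structure. *)
Definition ground := adjoin_field K 1.
HB.instance Definition _ := GRing.Field.on ground.
Definition ground_emb (y : ground) : L := val y.
HB.instance Definition _ := GRing.RMorphism.copy ground_emb
  (val : adjoin_field K 1 -> L).
End GroundField.
Arguments ground {L} K.
Arguments ground_emb {L K}.

Section Kummer.
Variables (L : fieldType) (K : {pred L}) (x : L).
Hypothesis dK : divring_closed K.

Local Notation K' := (ground K).
Local Notation iota := (@ground_emb L K).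
Local Notation emb := (map_poly iota).
Local Notation ev a q := (emb q).[a].

Let evB a (q r : {poly K'}) : ev a (q - r) = ev a q - ev a r.
Proof. by rewrite rmorphB /= hornerD hornerN. Qed.

Let evM a (q r : {poly K'}) : ev a (q * r) = ev a q * ev a r.
Proof. by rewrite rmorphM /= hornerM. Qed.

Lemma mem_adjoin1 : adjoin K 1 =i K.
Proof.
move=> y; apply/idP/idP; last exact: adjoin_base.
by move/asboolP; apply=> //; case: dK.
Qed.

Lemma val_ground (y : K') : iota y \in K.
Proof. by rewrite -mem_adjoin1; exact: adjoin_valP. Qed.

Lemma ground_lift y : y \in K -> exists y' : K', iota y' = y.
Proof. by rewrite -mem_adjoin1 => Ky; exists (AdjoinField Ky : K'). Qed.

(** The hypotheses below make [us] the full list of n-th roots of unity, n = [size us], and [e] the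
    order of x modulo the nonzero elements of K. *)
Variables (us : seq L) (e : nat).
Hypotheses (us_uniq : uniq us) (us_gt0 : (0 < size us)%N).
Hypothesis usK : {subset us <= K}.
Hypothesis us1 : forall u, u \in us -> u ^+ size us = 1.
Hypotheses (x_neq0 : x != 0) (xnK : x ^+ size us \in K).
Hypotheses (e_gt0 : (0 < e)%N) (xeK : x ^+ e \in K).
Hypothesis e_min : forall s, (0 < s < e)%N -> x ^+ s \notin K.

Lemma kummer_dvdn n : x ^+ n \in K -> (e %| n)%N.
Proof.
have [K1 KB Kdiv] := dK => xn.
rewrite /dvdn -leqn0 leqNgt; apply/negP => r0.
have := e_min (_ : (0 < n %% e < e)%N); rewrite r0 ltn_mod e_gt0 => /(_ isT).
case/negP; move: xn; rewrite {1}(divn_eq n e) exprD mulnC exprM => h.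
have -> : x ^+ (n %% e) =
    (x ^+ e) ^+ (n %/ e) * x ^+ (n %% e) / (x ^+ e) ^+ (n %/ e).
  by rewrite mulrAC mulfV ?mul1r // !expf_neq0.
apply: Kdiv => //; elim: (_ %/ _)%N => [|m IHm]; first by rewrite expr0.
have [y Ey] := ground_lift IHm; have [z Ez] := ground_lift xeK.
by rewrite exprS -Ey -Ez -rmorphM val_ground.
Qed.

Lemma kummer_split :
  'X^(size us) - (x ^+ size us)%:P = \prod_(u <- us) ('X - (u * x)%:P).
Proof.
set n := size us.
have sX : size ('X^n - (x ^+ n)%:P) = n.+1 by rewrite size_XnsubC.
rewrite [LHS](@all_roots_prod_XsubC _ _ [seq u * x | u <- us]); first last.
- by rewrite uniq_rootsE map_inj_uniq //; apply: mulIf.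
- apply/allP => _ /mapP[u uus ->]; rewrite /root !hornerE.
  by rewrite exprMn us1 // mul1r subrr.
- by rewrite sX size_map.
rewrite lead_coefXnsubC // scale1r big_map.
by [].
Qed.

Variable c : K'.
Hypothesis val_c : iota c = x ^+ e.
Local Notation m := ('X^e - c%:P).

Let emb_m : emb m = 'X^e - (x ^+ e)%:P.
Proof. by rewrite rmorphB rmorphXn /= map_polyX map_polyC /= val_c. Qed.

Let ev_m a : a ^+ e = 1 -> ev (a * x) m = 0.
Proof. by move=> a1; rewrite emb_m !hornerE exprMn a1 mul1r subrr. Qed.

(* Any divisor of X^n - x^n has constant term (up to elements of K) a power of x
   whose exponent is the degree of the divisor, hence at least e. *)
Lemma kummer_coprime (q : {poly K'}) : q != 0 -> (size q <= e)%N ->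
  coprimep q m.
Proof.
move=> q0 qe; set G := gcdp q m; rewrite /coprimep -/G.
have G0 : G != 0 by rewrite gcdp_eq0 negb_and q0.
have sG : (size G <= e)%N by apply: leq_trans qe; rewrite dvdp_leq ?dvdp_gcdl.
have : emb G %| \prod_(u <- us) ('X - (u * x)%:P).
  rewrite -kummer_split; apply: (@dvdp_trans _ (emb m)).
    by rewrite dvdp_map dvdp_gcdr.
  rewrite emb_m; have /dvdnP[k ->] := kummer_dvdn xnK.
  rewrite mulnC !exprM; set y := 'X^e.
  by rewrite !polyC_exp [X in _ %| X]subrXX dvdp_mulIl.
case/dvdp_prod_XsubC=> msk /eqpf_eq[a a0 EG].
set vs := mask msk us in EG.
have sGvs : size G = (size vs).+1.
  by rewrite -(size_map_poly (val : K' -> L)) EG size_scale // size_prod_XsubC.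
have aE : a = iota (lead_coef G).
  have := congr1 lead_coef EG; rewrite lead_coef_map lead_coefZ.
  by rewrite (eqP (monic_prod_XsubC _ _ _)) mulr1.
(* A nonempty [vs] has fewer than [e] elements, and the constant term of [G] would put
   [x ^+ size vs] in K, against [e_min]. *)
apply/eqP; rewrite sGvs; case: (posnP (size vs)) => [->//|vs0].
have /negP[] : x ^+ size vs \notin K by apply: e_min; rewrite vs0 -sGvs.
have vsK v : v \in vs -> v \in K by move/mem_mask; exact: usK.
have vsn0 v : v \in vs -> v != 0.
  move/mem_mask/us1 => v1; apply/eqP => v0; move: v1.
  by rewrite v0 expr0n gtn_eqF // => /eqP; rewrite eq_sym oner_eq0.
have [w Ew wn0] : exists2 w : K', iota w = \prod_(v <- vs) v & w != 0.
  elim: vs {EG sGvs vs0} vsK vsn0 => [|v vs IHvs] vsK vsn0.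
    by exists 1; rewrite ?big_nil ?rmorph1 ?oner_neq0.
  have [v' Ev'] := ground_lift (vsK v (mem_head _ _)).
  have [||w Ew wn0] := IHvs.
  - by move=> y yvs; rewrite vsK // inE yvs orbT.
  - by move=> y yvs; rewrite vsn0 // inE yvs orbT.
  exists (v' * w); first by rewrite rmorphM /= Ev' Ew big_cons.
  apply: mulf_neq0 => //; apply/eqP => v'0.
  by move: (vsn0 _ (mem_head v vs)); rewrite -Ev' v'0 rmorph0 eqxx.
have : iota (G`_0) = a * ((-1) ^+ size vs * iota w * x ^+ size vs).
  rewrite -coef_map EG coefZ; congr (_ * _).
  rewrite -horner_coef0 horner_prod Ew.
  elim: vs {EG sGvs vs0 vsK vsn0 Ew} => [|v vs IHvs].
    by rewrite !big_nil !mul1r.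
  rewrite !big_cons IHvs !hornerE !exprS /=; ring.
rewrite aE => E.
have lc0 : lead_coef G != 0 by rewrite lead_coef_eq0.
have -> : x ^+ size vs = iota (G`_0 / (lead_coef G * ((-1) ^+ size vs * w))).
  rewrite fmorph_div /= E !rmorphM /= rmorphXn rmorphN1.
  have s0 : iota (lead_coef G) * ((-1) ^+ size vs * iota w) != 0.
    by rewrite !mulf_neq0 ?fmorph_eq0 // expf_neq0 // oppr_eq0 oner_neq0.
  by rewrite !mulrA in s0 *; rewrite mulrAC mulfV ?mul1r.
exact: val_ground.
Qed.

Lemma kummer_mod_root (q : {poly K'}) : ev x q = ev x (q %% m).
Proof.
have evm0 := ev_m (expr1n _ e); rewrite mul1r in evm0.
by rewrite {1}(divp_eq q m) rmorphD rmorphM /= hornerD hornerM evm0 mulr0 add0r.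
Qed.

Let m_neq0 : m != 0.
Proof. by rewrite -size_poly_eq0 size_XnsubC. Qed.

Let size_mod (q : {poly K'}) : (size (q %% m)%R <= e)%N.
Proof. by rewrite -ltnS -(size_XnsubC c e_gt0) ltn_modp. Qed.

(** A nonzero remainder is coprime to [m]; the Bezout relation evaluated at x gives the inverse. *)
Lemma kummer_unit (q : {poly K'}) : q %% m != 0 ->
  exists r : {poly K'}, ev x r * ev x q = 1.
Proof.
move=> q0; have /Bezout_eq1_coprimepP[[a b] /= ab1] :=
  kummer_coprime q0 (size_mod q).
exists a; have := congr1 (fun r => ev x r) ab1.
rewrite rmorphD !rmorphM rmorph1 /= hornerD !hornerM hornerC -kummer_mod_root.
by have := ev_m (expr1n _ e); rewrite mul1r => ->; rewrite mulr0 addr0.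
Qed.

(** By [kummer_unit] a polynomial vanishing at x is a multiple of [m], and [m] vanishes at ax
    too. *)
Lemma kummer_conj_root (q : {poly K'}) a : a ^+ e = 1 ->
  ev x q = 0 -> ev (a * x) q = 0.
Proof.
move=> a1 q0; have [qm0|/kummer_unit[r]] := eqVneq (q %% m) 0; last first.
  by rewrite q0 mulr0 => /eqP; rewrite eq_sym oner_eq0.
by rewrite (divp_eq q m) qm0 addr0 rmorphM /= hornerM ev_m // mulr0.
Qed.

(** K[x] is already closed under division, thanks to the Bezout inverses. *)
Lemma adjoin_polyP y : y \in adjoin K x -> exists q : {poly K'}, y = ev x q.
Proof.
move/asboolP/(_ (fun z => `[< exists q : {poly K'}, z = ev x q >])) => H.
apply/asboolP; apply: H.
- split.
  + by apply/asboolP; exists 1; rewrite rmorph1 hornerC.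
  + move=> z1 z2 /asboolP[q1 ->] /asboolP[q2 ->]; apply/asboolP.
    by exists (q1 - q2); rewrite rmorphB /= hornerD hornerN.
  + move=> z1 z2 /asboolP[q1 ->] /asboolP[q2 ->]; apply/asboolP.
    have [qm0|/kummer_unit[r r1]] := eqVneq (q2 %% m) 0.
      (* The denominator is zero here, and the quotient is 0 by convention. *)
      by exists 0; rewrite (kummer_mod_root q2) qm0 !rmorph0 horner0 invr0 mulr0.
    exists (q1 * r); rewrite rmorphM /= hornerM; congr (_ * _).
    have q2n0 : ev x q2 != 0.
      by apply/eqP => q20; move/eqP: r1; rewrite q20 mulr0 eq_sym oner_eq0.
    by apply: (mulIf q2n0); rewrite r1 mulVf.
- move=> z /ground_lift[z' <-]; apply/asboolP; exists z'%:P.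
  by rewrite map_polyC hornerC.
- by apply/asboolP; exists 'X; rewrite map_polyX hornerX.
Qed.

Lemma ev_adjoin (q : {poly K'}) a : a \in adjoin K x -> ev a q \in adjoin K x.
Proof.
move=> ax; apply: rpred_horner => //; apply/polyOverP => i.
by rewrite coef_map; apply: adjoin_base; exact: val_ground.
Qed.

Section Automorphism.
Variable a : L.
Hypotheses (aK : a \in K) (a1 : a ^+ e = 1).

Let ax : a * x \in adjoin K x.
Proof. by rewrite rpredM ?adjoin_gen // adjoin_base. Qed.

(** An arbitrary polynomial representing y is evaluated at ax; [kummer_funE] shows that the choice
    does not matter. *)
Definition kummer_fun (y : adjoin_field K x) : adjoin_field K x :=
  AdjoinField (ev_adjoin (projT1 (cid (adjoin_polyP (adjoin_valP y)))) ax).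

Lemma kummer_funE y (q : {poly K'}) : val y = ev x q ->
  val (kummer_fun y) = ev (a * x) q.
Proof.
rewrite /=; case: cid => r /= Er yq; apply/eqP; rewrite -subr_eq0 -hornerN -hornerD.
rewrite -rmorphB; apply/eqP; apply: kummer_conj_root => //.
by rewrite rmorphB /= hornerD hornerN -Er yq subrr.
Qed.

Lemma kummer_fun_gen : val (kummer_fun (adjoin_elt K x)) = a * x.
Proof. by rewrite (@kummer_funE _ 'X) ?map_polyX ?hornerX. Qed.

End Automorphism.

(** Scaling the variable by a turns evaluation at bx into evaluation at bax, so the two maps compose
    to the one for ba = 1. *)
Lemma kummer_fun_can a b (aK : a \in K) (bK : b \in K)
    (a1 : a ^+ e = 1) (b1 : b ^+ e = 1) :
  b * a = 1 -> cancel (kummer_fun aK) (kummer_fun bK).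
Proof.
move=> ba y; have [q Eq] := adjoin_polyP (adjoin_valP y).
have [a' Ea] := ground_lift aK.
apply: val_inj; rewrite [RHS]Eq.
have E b' : ev (b' * a * x) q = ev (b' * x) (q \Po (a' *: 'X)).
  rewrite map_comp_poly horner_comp map_polyZ map_polyX /= hornerZ hornerX Ea.
  by rewrite mulrCA mulrA mulrC mulrA mulrAC.
rewrite (@kummer_funE b bK b1 _ (q \Po (a' *: 'X))) -?E ?ba ?mul1r //.
by rewrite (@kummer_funE a aK a1 _ q) // -{2}(mul1r x) -E mul1r.
Qed.

Lemma kummer_aut a : a \in K -> a ^+ e = 1 ->
  exists s : gal (adjoin_ground K x), val (s (adjoin_elt K x)) = a * x.
Proof.
move=> aK a1; have a0 : a != 0.
  apply/eqP => a0; move/eqP: a1; rewrite a0 expr0n gtn_eqF // eq_sym.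
  by rewrite oner_eq0.
have aVK : a^-1 \in K by case: dK => K1 _ /(_ 1 a K1 aK); rewrite mul1r.
have aV1 : a^-1 ^+ e = 1 by rewrite exprVn a1 invr1.
suff sP : `[< field_aut (adjoin_ground K x) (kummer_fun aK) >].
  by exists (MkGal sP); exact: kummer_fun_gen.
have valE (y : adjoin_field K x) := adjoin_polyP (adjoin_valP y).
apply/asboolP; split.
- move=> y z; have [[q Eq] [r Er]] := (valE y, valE z).
  apply: val_inj; rewrite (kummer_funE aK a1 (q := q - r)); last first.
    by rewrite evB -Eq -Er; exact: rmorphB.
  rewrite evB -(kummer_funE aK a1 Eq) -(kummer_funE aK a1 Er).
  by symmetry; exact: rmorphB.
- split=> [|y z].
    have ev1 b : ev b 1 = 1 by rewrite rmorph1 hornerC.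
    by apply: val_inj; rewrite (kummer_funE aK a1 (q := 1)) ev1.
  have [[q Eq] [r Er]] := (valE y, valE z).
  apply: val_inj; rewrite (kummer_funE aK a1 (q := q * r)); last first.
    by rewrite evM -Eq -Er; exact: rmorphM.
  rewrite evM -(kummer_funE aK a1 Eq) -(kummer_funE aK a1 Er).
  by symmetry; exact: rmorphM.
- exists (kummer_fun aVK); apply: kummer_fun_can; rewrite ?mulVf ?mulfV //.
- move=> y Ky; have [y0 Ey] := ground_lift Ky; apply: val_inj.
  by rewrite (kummer_funE aK a1 (q := y0%:P)) map_polyC hornerC.
Qed.

End Kummer.

(** * The Galois group *)

Section LaurentOfPoly.
Variable F : fieldType.

Fact fps_of_poly_zmod : zmod_morphism (@fps_of_poly F).
Proof. by move=> q r; apply: fpsP => n; rewrite /= coefB. Qed.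

Fact fps_of_poly_monoid : monoid_morphism (@fps_of_poly F).
Proof.
by split=> [|q r]; apply: fpsP => n; [rewrite /= coef1 | rewrite /= coefM].
Qed.

HB.instance Definition _ := GRing.isZmodMorphism.Build {poly F} (fps F)
  (@fps_of_poly F) fps_of_poly_zmod.
HB.instance Definition _ := GRing.isMonoidMorphism.Build {poly F} (fps F)
  (@fps_of_poly F) fps_of_poly_monoid.
HB.instance Definition _ := GRing.RMorphism.copy (@laurent_of_poly F)
  (@tofrac (fps F) \o @fps_of_poly F).

Lemma laurentB q r :
  laurent_of_poly (q - r) = laurent_of_poly q - laurent_of_poly r :> laurent F.
Proof. exact: rmorphB. Qed.

Lemma laurentM q r :
  laurent_of_poly (q * r) = laurent_of_poly q * laurent_of_poly r :> laurent F.
Proof. exact: rmorphM. Qed.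

Lemma laurent1 : laurent_of_poly 1 = 1 :> laurent F.
Proof. exact: rmorph1. Qed.

Lemma laurent0 : laurent_of_poly 0 = 0 :> laurent F.
Proof. exact: rmorph0. Qed.

Lemma laurentX q n :
  laurent_of_poly (q ^+ n) = laurent_of_poly q ^+ n :> laurent F.
Proof. exact: rmorphXn. Qed.

Lemma laurent_of_poly_inj : injective (@laurent_of_poly F).
Proof.
move=> q r /eqP; rewrite /laurent_of_poly tofrac_eq => /eqP qr.
by apply/polyP => n; have := congr1 (fun a : fps F => a n) qr.
Qed.

Lemma laurent_of_poly_eq0 q : (laurent_of_poly q == 0) = (q == 0 :> {poly F}).
Proof. by rewrite -laurent0 (inj_eq laurent_of_poly_inj). Qed.

Lemma laurent_of_poly_ratfun q : laurent_of_poly q \in ratfun F.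
Proof.
by apply/asboolP; exists q, 1; rewrite oner_neq0 laurent1 divr1.
Qed.

Lemma ratfun_divring_closed : divring_closed (ratfun F).
Proof.
have sub_div (M : fieldType) (a b c d : M) : b != 0 -> d != 0 ->
    a / b - c / d = (a * d - c * b) / (b * d).
  by move=> b0 d0; rewrite -mulNr addf_div // mulNr.
have div_div (M : fieldType) (a b c d : M) : a / b / (c / d) = a * d / (b * c).
  by rewrite invf_div mulf_div.
split.
- by rewrite -laurent1; exact: laurent_of_poly_ratfun.
- move=> _ _ /asboolP[q1 [r1 [r10 ->]]] /asboolP[q2 [r2 [r20 ->]]].
  apply/asboolP; exists (q1 * r2 - q2 * r1), (r1 * r2).
  split; first exact: mulf_neq0.
  by rewrite laurentB !laurentM sub_div ?laurent_of_poly_eq0.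
- move=> _ _ /asboolP[q1 [r1 [r10 ->]]] /asboolP[q2 [r2 [r20 ->]]].
  apply/asboolP; have [->|q20] := eqVneq q2 0.
    by exists 0, 1; rewrite oner_neq0 laurent0 !mul0r invr0 mulr0.
  exists (q1 * r2), (r1 * q2).
  by split; [exact: mulf_neq0 | rewrite div_div !laurentM].
Qed.

End LaurentOfPoly.

(** The elements on which s and t agree form a subfield containing K and x. *)
Lemma gal_eq (L : fieldType) (K : {pred L}) (x : L) (s t : gal (adjoin_ground K x)) :
  s (adjoin_elt K x) = t (adjoin_elt K x) -> s = t.
Proof.
move=> st; apply: val_inj; apply: funext => y /=.
have [sB [s1 sM] _ sK] := gal_aut s; have [tB [t1 tM] _ tK] := gal_aut t.
have sV (r : gal (adjoin_ground K x)) z : r z^-1 = (r z)^-1.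
  have [rB [r1 rM] _ _] := gal_aut r.
  have r0 : r 0 = 0 by have := rB 0 0; rewrite !subrr.
  have [->|z0] := eqVneq z 0; first by rewrite invr0 r0 invr0.
  have rz : r z^-1 * r z = 1 by rewrite -rM mulVf // r1.
  have rz0 : r z != 0.
    by apply/eqP => e; move/eqP: rz; rewrite e mulr0 eq_sym oner_eq0.
  by apply: (mulIf rz0); rewrite rz mulVf.
pose E z := `[< exists2 y, val y = z & s y = t y >].
have /asboolP/(_ E) Ey := adjoin_valP y.
have [] : exists2 y', val y' = val y & s y' = t y'; last first.
  by move=> y' /val_inj ->.
apply/asboolP; apply: Ey; first split.
- by apply/asboolP; exists 1; rewrite ?s1 ?t1.
- move=> _ _ /asboolP[y1 <- e1] /asboolP[y2 <- e2]; apply/asboolP.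
  by exists (y1 - y2); rewrite ?sB ?tB ?e1 ?e2.
- move=> _ _ /asboolP[y1 <- e1] /asboolP[y2 <- e2]; apply/asboolP.
  by exists (y1 / y2); rewrite ?fmorph_div // sM tM !sV e1 e2.
- move=> z Kz; apply/asboolP; exists (AdjoinField (adjoin_base x Kz)) => //.
  by rewrite sK ?tK.
- by apply/asboolP; exists (adjoin_elt K x).
Qed.

Lemma field_aut_exp (M : fieldType) (K : {pred M}) (s : gal K) y n :
  s (y ^+ n) = s y ^+ n.
Proof.
have [_ [s1 sM] _ _] := gal_aut s.
by elim: n => [|n IHn]; rewrite ?expr0 // !exprS sM IHn.
Qed.

Section SquaresFp.
Variables (p : nat) (p_pr : prime p) (p_odd : odd p).

Lemma card_unit_Fp : #|{: {unit 'F_p}}| = p.-1.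
Proof. by rewrite -cardsT card_finField_unit card_Fp. Qed.

Lemma unit_Fp_exp (v : {unit 'F_p}) : (v ^+ p.-1)%g = 1%g.
Proof. by rewrite -card_unit_Fp -cardsT expg_cardG ?inE. Qed.

(** Euler's criterion: writing v = g^k in the cyclic group of order p-1, the power is trivial
    exactly when k is even. *)
Lemma squares_exp (v : {unit 'F_p}) : (v \in squares p) = ((v ^+ p./2)%g == 1%g).
Proof.
have p2 : p.-1 = (2 * p./2)%N.
  by have := odd_double_half p; rewrite p_odd -muln2; lia.
apply/imsetP/eqP => [[w _ ->]|v1]; first by rewrite -expgM -p2 unit_Fp_exp.
have /cyclicP[g Eg] := field_unit_group_cyclic [set: {unit 'F_p}]%G.
have og : #[g]%g = p.-1 by rewrite /order -Eg cardsT card_unit_Fp.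
have /cycleP[k Ek] : v \in <[g]>%g by rewrite -Eg inE.
move/eqP: v1; rewrite Ek -expgM -order_dvdn og p2 dvdn_pmul2r; last first.
  by have := prime_gt1 p_pr; have := p_odd; lia.
by case/dvdnP=> j ->; exists (g ^+ j)%g; rewrite ?inE // -expgM.
Qed.

End SquaresFp.

Section Galois.
Variables (p : nat) (p_pr : prime p) (p_odd : odd p).
Local Notation F := 'F_p.
Local Notation K := (ratfun F).
Local Notation f := (tofrac (f_xi p) : laurent F).
Local Notation cst c := (laurent_of_poly (c : F)%:P).

Lemma f_xi_neq0 : f != 0.
Proof.
rewrite tofrac_eq0; apply/eqP => /(congr1 (fun a : fps F => a 0%N)) /=.
rewrite (xiE _ (ltn0Sn 0)) big_nat1 /xi_term /= !expr0 !mulr1 => /eqP.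
by rewrite oner_eq0.
Qed.

Lemma f_xi_exp : laurent_of_poly (A_xi p) * f ^+ p.-1 = 1.
Proof.
apply: (mulIf f_xi_neq0); rewrite mul1r -mulrA -exprSr (prednK (prime_gt0 p_pr)).
by rewrite [RHS](congr1 (@tofrac _) (f_xi_frobenius p_pr p_odd)) rmorphM rmorphXn.
Qed.

Lemma f_xi_expK : f ^+ p.-1 \in K.
Proof.
have [K1 _ Kdiv] := ratfun_divring_closed F.
have A0 : laurent_of_poly (A_xi p) != 0.
  by apply/eqP => A0; have /eqP := f_xi_exp; rewrite A0 mul0r eq_sym oner_eq0.
rewrite -(mulKf A0 (f ^+ _)) f_xi_exp mulr1 -[_^-1]mul1r.
by apply: Kdiv => //; exact: laurent_of_poly_ratfun.
Qed.

(** With f^e = q/r, the relation A f^(p-1) = 1 gives A q^d = r^d; hence q divides r and A is the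
    d-th power of r/q. *)
Lemma A_xi_power e d : (0 < d)%N -> p.-1 = (e * d)%N -> f ^+ e \in K ->
  exists C : {poly F}, A_xi p = C ^+ d.
Proof.
move=> d0 ed /asboolP[q [r [r0 fe]]].
have lr0 : laurent_of_poly r != 0 by rewrite laurent_of_poly_eq0.
have q0 : q != 0.
  rewrite -laurent_of_poly_eq0; apply/eqP => q0; move/eqP: fe.
  by rewrite q0 mul0r expf_eq0 (negPf f_xi_neq0) andbF.
have E : A_xi p * q ^+ d = r ^+ d.
  apply: laurent_of_poly_inj; rewrite laurentM !laurentX.
  have := f_xi_exp; rewrite ed exprM fe expr_div_n mulrA => /(canRL (mulfVK _)).
  by rewrite mul1r; apply; rewrite expf_neq0.
have /dvdpP[C rC] : q %| r by rewrite -(dvdp_pexp2r _ _ d0) -E dvdp_mulIr.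
exists C; apply: (mulIf (expf_neq0 d q0)).
by rewrite E rC exprMn.
Qed.

Let us : seq (laurent F) := [seq cst (val v) | v <- enum {: {unit F}}].

Let size_us : size us = p.-1.
Proof. by rewrite size_map -cardE card_unit_Fp. Qed.

Lemma cst_inj : injective (fun c : F => cst c).
Proof. by move=> c c' /laurent_of_poly_inj/polyC_inj. Qed.

Let us_uniq : uniq us.
Proof.
rewrite map_inj_uniq ?enum_uniq // => v w /cst_inj; exact: val_inj.
Qed.

Lemma cstX c n : cst (c ^+ n) = cst c ^+ n.
Proof. by rewrite polyC_exp laurentX. Qed.

Lemma cst_unit_exp (v : {unit F}) n :
  (cst (val v) ^+ n == 1) = ((v ^+ n)%g == 1%g).
Proof.
rewrite -cstX -laurent1 -polyC1 (inj_eq cst_inj).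
have <- : val (v ^+ n)%g = val v ^+ n by exact: FinRing.val_unitX.
exact: (inj_eq val_inj (v ^+ n)%g 1%g).
Qed.

Let us1 v : v \in us -> v ^+ size us = 1.
Proof.
case/mapP=> w _ ->; apply/eqP; rewrite cst_unit_exp size_us.
by rewrite (unit_Fp_exp p_pr).
Qed.

(** The p-1 nonzero constants already exhaust the roots of X^(p-1) - 1. *)
Lemma root_of_unity (v : laurent F) : v ^+ p.-1 = 1 ->
  exists w : {unit F}, v = cst (val w).
Proof.
move=> v1; have p0 : (0 < p.-1)%N by have := prime_gt1 p_pr; lia.
have [/mapP[w _ ->]|vus] := boolP (v \in us); first by exists w.
have := @max_poly_roots _ ('X^(p.-1) - 1%:P : {poly laurent F}) (v :: us).
rewrite size_XnsubC // -size_poly_eq0 size_XnsubC //= size_us ltnn vus us_uniq.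
have -> : root ('X^(p.-1) - 1%:P) v by rewrite /root !hornerE v1 subrr.
have -> : all (root ('X^(p.-1) - 1%:P : {poly laurent F})) us.
  apply/allP => w wus; rewrite /root !hornerE -size_us us1 //.
  by rewrite subrr.
by move=> /(_ isT isT isT).
Qed.

Local Notation G := (Gal_xi p).
Local Notation fM := (f_xi_elt p).

Lemma gal_exp_fixed (s : G) n : f ^+ n \in K -> val (s fM) ^+ n = f ^+ n.
Proof.
move=> fnK; have [_ _ _ sK] := gal_aut s.
have vX (y : adjoin_field K f) : val (y ^+ n) = val y ^+ n by exact: rmorphXn.
have fMnK : fM ^+ n \in adjoin_ground K f by rewrite inE vX.
by rewrite -vX -field_aut_exp sK // vX.
Qed.

Lemma gal_ratio_ex (s : G) : exists w : {unit F}, val (s fM) / val fM = cst (val w).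
Proof.
apply: root_of_unity; rewrite expr_div_n gal_exp_fixed ?f_xi_expK //.
by rewrite mulfV // expf_neq0 // f_xi_neq0.
Qed.

Definition kummer_char (s : G) : {unit F} := projT1 (cid (gal_ratio_ex s)).

Lemma kummer_charE (s : G) : val (s fM) = cst (val (kummer_char s)) * f.
Proof.
rewrite /kummer_char; case: cid => w /= <-.
by rewrite divfK // f_xi_neq0.
Qed.

Lemma kummer_char_is_multiplicative :
  {morph kummer_char : s t / (s * t)%g >-> (s * t)%g}.
Proof.
move=> s t; apply/val_inj/cst_inj; apply: (mulIf f_xi_neq0).
have [_ [_ sM] _ sK] := gal_aut s.
pose z : adjoin_field K f :=
  AdjoinField (adjoin_base f (laurent_of_poly_ratfun (val (kummer_char t))%:P)).
have tz : t fM = z * fM by apply: val_inj; rewrite kummer_charE.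
have -> : val (kummer_char s * kummer_char t)%g =
  val (kummer_char s) * val (kummer_char t) by exact: FinRing.val_unitM.
have cstM (c d : F) : cst (c * d) = cst c * cst d by rewrite polyCM laurentM.
rewrite -kummer_charE cstM mulrAC -kummer_charE mulrC.
have -> : (s * t)%g fM = s (t fM) by [].
rewrite tz sM (sK z) //.
by rewrite inE laurent_of_poly_ratfun.
Qed.

Lemma kummer_char_inj : injective kummer_char.
Proof.
move=> s t st; apply: gal_eq; apply: val_inj.
by rewrite !kummer_charE st.
Qed.

HB.instance Definition _ := isMultiplicative.Build G {unit F} kummer_char
  kummer_char_is_multiplicative.

Lemma kummer_image e : (0 < e)%N -> f ^+ e \in K ->
    (forall s, (0 < s < e)%N -> f ^+ s \notin K) ->
  image_set kummer_char = [set v | (v ^+ e)%g == 1%g].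
Proof.
move=> e0 feK emin; have [c Ec] := ground_lift (ratfun_divring_closed F) feK.
apply/setP => v; rewrite !inE; apply/asboolP/idP => [[s <-]|].
  rewrite -cst_unit_exp; apply/eqP.
  apply: (mulIf (expf_neq0 e f_xi_neq0)); rewrite mul1r -exprMn -kummer_charE.
  exact: gal_exp_fixed.
rewrite -cst_unit_exp => /eqP ve.
have vK : cst (val v) \in K by apply: laurent_of_poly_ratfun.
have usK : {subset us <= K}.
  by move=> _ /mapP[w _ ->]; apply: laurent_of_poly_ratfun.
have fnK : f ^+ size us \in K by rewrite size_us f_xi_expK.
have us0 : (0 < size us)%N by rewrite size_us; have := prime_gt1 p_pr; lia.
have [s Es] := kummer_aut (ratfun_divring_closed F) us_uniq us0 usK us1
  f_xi_neq0 fnK e0 feK emin Ec vK ve.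
exists s; apply/val_inj/cst_inj; apply: (mulIf f_xi_neq0).
by rewrite -kummer_charE.
Qed.

Lemma f_xi_min_exponent : exists e : nat,
  [/\ (0 < e)%N, f ^+ e \in K & forall s, (0 < s < e)%N -> f ^+ s \notin K].
Proof.
have exn : exists n, (0 < n)%N && (f ^+ n \in K).
  by exists p.-1; rewrite f_xi_expK andbT; have := prime_gt1 p_pr; lia.
case: (ex_minnP exn) => e /andP[e0 feK] emin; exists e; split=> // s /andP[s0 se].
by apply/negP => fsK; move: (emin s); rewrite s0 fsK => /(_ isT); rewrite leqNgt se.
Qed.

Lemma image_kummer_char13 N : ((8 * N).+1 == p) || ((8 * N).+3 == p) ->
  image_set kummer_char = squares p.
Proof.
move=> Np; have [e [e0 feK emin]] := f_xi_min_exponent.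
have AB := A_xi_13 p_pr p_odd Np; set B := pull _ _ in AB.
have p2 : p.-1 = (p./2 * 2)%N.
  by have := odd_double_half p; rewrite p_odd -muln2; lia.
have B0 : laurent_of_poly B != 0.
  apply/eqP => B0; have /eqP := f_xi_exp.
  by rewrite AB laurentX B0 expr0n mul0r eq_sym oner_eq0.
(* From A = B^2, the product of B and f^(p/2) squares to 1, so it is 1 or -1. *)
have fhK : f ^+ p./2 \in K.
  have [K1 KB Kdiv] := ratfun_divring_closed F.
  have BK : (laurent_of_poly B)^-1 \in K.
    by rewrite -[_^-1]mul1r Kdiv // laurent_of_poly_ratfun.
  have : (laurent_of_poly B * f ^+ p./2) ^+ 2 == 1 ^+ 2.
    by rewrite exprMn -exprM -p2 -laurentX -AB f_xi_exp expr1n.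
  rewrite eqf_sqr => BE; rewrite -(mulKf B0 (f ^+ _)).
  case/orP: BE => /eqP->; first by rewrite mulr1.
  have K0 : 0 \in K by rewrite -(subrr 1); exact: KB.
  by rewrite mulrN mulr1 -sub0r; exact: KB.
have /dvdnP[d pd] :=
  kummer_dvdn (ratfun_divring_closed F) f_xi_neq0 e0 feK emin fhK.
have d0 : (0 < d)%N by case: d pd => // pd; have := prime_gt1 p_pr; lia.
have pd2 : p.-1 = (e * (d * 2))%N by rewrite p2 pd; lia.
have [|C AC] := A_xi_power _ pd2 feK; first by rewrite muln_gt0 d0.
suff d1 : (d <= 1)%N.
  have ep : e = p./2 by rewrite pd; case: d d0 d1 {pd pd2 AC} => [|[]] //=; lia.
  rewrite (kummer_image e0 feK emin) ep; apply/setP => v.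
  by rewrite inE (squares_exp p_pr p_odd).
rewrite leqNgt; apply/negP => d_gt1.
(* A = C^(2d) makes B equal to C^d up to sign; squarefreeness then makes C constant. *)
have CB : C ^+ 2 %| B.
  apply: (@dvdp_trans _ (C ^+ d)); first by rewrite dvdp_exp2l.
  have : B ^+ 2 == (C ^+ d) ^+ 2 by rewrite -AB AC exprM.
  by rewrite eqf_sqr => /orP[]/eqP->; rewrite ?dvdpNr dvdpp.
have /eqP/size_poly1P[c c0 Cc] := pull13_squarefree p_pr p_odd Np CB.
have p3 : p <> 3.
  move=> p3; move: pd d_gt1; rewrite p3 => /esym/eqP.
  by rewrite muln_eq1 => /andP[/eqP-> _].
(* A would be constant, yet its coefficient [xi 1] = -3 is nonzero for [p <> 3]; the case [p = 3]
   has been excluded because p/2 = 1 forces d = 1. *)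
have : (A_xi p)`_1 = 0 by rewrite AC Cc -polyC_exp coefC.
rewrite coef_poly (prime_gt1 p_pr) (xiE _ (ltnSn 1)) big_nat_recr // big_nat1 /=.
rewrite (@xi_term_small _ 1 1) // addr0.
have -> : xi_term F 1 0 = - 3%:R.
  rewrite /xi_term (_ : trinom 1 0 = 1%N) // bin0 (_ : 1 - 3 * 0 = 1)%N //.
  by rewrite /subn /= !expr1; ring.
move/eqP; rewrite oppr_eq0 natFp_eq0 // dvdn_prime2 //.
by move/eqP.
Qed.

Lemma image_kummer_char57 N : ((8 * N + 5)%N == p) || ((8 * N + 7)%N == p) ->
  image_set kummer_char = [set: {unit F}].
Proof.
move=> Np; have [e [e0 feK emin]] := f_xi_min_exponent.
have /dvdnP[d pd] :=
  kummer_dvdn (ratfun_divring_closed F) f_xi_neq0 e0 feK emin f_xi_expK.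
have d0 : (0 < d)%N by case: d pd => // pd; have := prime_gt1 p_pr; lia.
rewrite mulnC in pd; have [C AC] := A_xi_power d0 pd feK.
have d1 := A_xi_57_not_power p_pr p_odd Np AC.
have ep : e = p.-1 by rewrite pd; case: d d0 d1 {pd AC} => [|[]] //=; lia.
rewrite (kummer_image e0 feK emin) ep; apply/setP => v.
by rewrite !inE (unit_Fp_exp p_pr) eqxx.
Qed.

End Galois.

Theorem theorem4 (p : nat) (p_prime : prime p)
    (p_mod8 : (p %% 8 \in [:: 1; 3; 5; 7])%N) :
  exists chi : {multiplicative Gal_xi p -> {unit 'F_p}},
  [/\ injective chi,
      forall s : Gal_xi p,
        val (s (f_xi_elt p)) / val (f_xi_elt p)
          = laurent_of_poly (val (chi s))%:P
    & exists B : {poly 'F_p},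
      ((p %% 8 \in [:: 1; 3])%N ->
         A_xi p = B ^+ 2 /\ image_set chi = squares p)
      /\
      ((p %% 8 \in [:: 5; 7])%N ->
         A_xi p = (81%:P * 'X^2 + 14%:P * 'X + 1) * B ^+ 2
         /\ image_set chi = [set: {unit 'F_p}])].
Proof.
have p_odd : odd p by move: p_mod8; rewrite !inE; lia.
exists (kummer_char p_prime p_odd : {multiplicative Gal_xi p -> {unit 'F_p}}); split.
- exact: kummer_char_inj.
- by move=> s; rewrite kummer_charE mulfK // f_xi_neq0.
have pE := divn_eq p 8; have [p13|p57] := boolP (p %% 8 \in [:: 1; 3])%N.
  have Np : ((8 * (p %/ 8)).+1 == p) || ((8 * (p %/ 8)).+3 == p).
    by move: p13; rewrite !inE; lia.
  exists (pull p./2 (hypgeom p 1 3 (p %/ 8))); split=> [_|]; last first.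
    by move: p13; rewrite !inE => /orP[]/eqP->.
  split; first exact: A_xi_13.
  exact: image_kummer_char13 Np.
have Np : ((8 * (p %/ 8) + 5)%N == p) || ((8 * (p %/ 8) + 7)%N == p).
  by move: p57 p_mod8; rewrite !inE; lia.
exists ((1 - 'X) * pull (p - 5)./2 (hypgeom p 5 7 (p %/ 8))); split=> // _.
split; first exact: A_xi_57.
exact: image_kummer_char57 Np.
Qed.
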